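(* Let $0<\alpha<1$ and $a,b,c\in\mathbb{R}$ with $c\neq 0$. If $0<a+b<\frac{-1}{4c}<a$ and $b<0$, then there exists $$\tau_*=\frac{-\log\left(\frac{-1-4ac}{4bc}\right)}{\left(\frac{-1}{2c}\right)^{1/\alpha}}$$ such that the equation $D^{\alpha}x(t)+c\,D^{2\alpha}x(t)=a\,x(t)+b\,x(t-\tau)$ is unstable if $0\le\tau<\tau_*$.
   Context: $D^{\mu}$ denotes the Caputo fractional derivative (base point $0$) in $t$: for $m\in\mathbb{N}$ and $m-1<\mu<m$, $D^{\mu}f(t)=\frac{1}{\Gamma(m-\mu)}\int_0^t (t-s)^{m-\mu-1}f^{(m)}(s)\,ds$, and $D^{m}f=f^{(m)}$. The equation is considered for $t>0$ with delay $\tau\ge 0$ and a prescribed history on $[-\tau,0]$ (together with a prescribed value $x'(0)$ when $1<2\alpha<2$). The characteristic equation is $\lambda^{\alpha}+c\lambda^{2\alpha}=a+b\,e^{-\lambda\tau}$ (principal branch of powers). For a given $\tau\ge 0$ the equation is called stable if all its solutions are bounded as $t\to\infty$, and unstable if it is not stable. The paper uses as its criterion that the existence of a positive real root $\lambda>0$ of the characteristic equation is sufficient for instability. *)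

(* Defs.v *)
From HB Require Import structures.
From mathcomp Require Import all_boot all_order all_algebra.
From mathcomp Require Import all_classical all_reals all_analysis.

Set Implicit Arguments.
Unset Strict Implicit.
Unset Printing Implicit Defensive.

Import Order.TTheory GRing.Theory Num.Theory.
Import numFieldNormedType.Exports.

Local Open Scope ring_scope.
Local Open Scope classical_set_scope.

Definition Gamma (R : realType) (z : R) : R :=
  \int[lebesgue_measure]_(t in `]0, +oo[) (t `^ (z - 1) * expR (- t)).

(* The integer m with m - 1 < mu <= m, for mu > 0. *)
Definition caputo_order (R : realType) (mu : R) : nat := `|Num.ceil mu|%N.

Definition caputo_kernel (R : realType) (mu : R) (f : R -> R) (t s : R) : R :=
  let m := caputo_order mu in (t - s) `^ (m%:R - mu - 1) * derive1n m f s.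

Definition caputo (R : realType) (mu : R) (f : R -> R) (t : R) : R :=
  let m := caputo_order mu in
  if mu == m%:R then derive1n m f t
  else (Gamma (m%:R - mu))^-1 *
       \int[lebesgue_measure]_(s in `[0, t]) caputo_kernel mu f t s.

(* The operators [caputo], [derive1n] and [Rintegral] are total; this says that
   the value [caputo mu f t] is meaningful. *)
Definition has_caputo (R : realType) (mu : R) (f : R -> R) (t : R) : Prop :=
  let m := caputo_order mu in
  if mu == m%:R then derivable (derive1n m.-1 f) t 1
  else lebesgue_measure.-integrable `[0, t]
         (fun s => (caputo_kernel mu f t s)%:E).

(* Absolute continuity on every [0, T], in the form: the derivative, which may
   fail to exist on a null set, is integrable and the function is its primitive.
   Caputo derivatives need this (it excludes singular functions), while asking
   for more would be too strong: solutions behave like t^(2 alpha) at 0 and have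
   similar singularities of the derivative at multiples of the delay. *)
Definition loc_abs_cont (R : realType) (f : R -> R) : Prop :=
  forall T : R, 0 < T ->
    lebesgue_measure.-integrable `[0, T] (fun s => (derive1 f s)%:E) /\
    f T = f 0 + \int[lebesgue_measure]_(s in `[0, T]) derive1 f s.

(* [x] solves D^alpha x + c D^(2 alpha) x = a x + b x(. - tau) on t > 0 with
   history [phi] on [- tau, 0] and, when 1 < 2 alpha, x'(0) = x1 (as a right
   derivative); [x1] plays no role otherwise.  Only the values of [x] on
   [- tau, +oo[ matter. *)
Definition is_solution (R : realType) (alpha a b c tau : R)
    (phi : R -> R) (x1 : R) (x : R -> R) : Prop :=
  [/\ forall t, - tau <= t <= 0 -> x t = phi t,
      loc_abs_cont x,
      1 < 2 * alpha ->
        (forall t, 0 < t -> derivable x t 1) /\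
        loc_abs_cont (fun t => if t == 0 then x1 else derive1 x t),
      forall t, 0 < t -> has_caputo alpha x t /\ has_caputo (2 * alpha) x t
    & forall t, 0 < t ->
        caputo alpha x t + c * caputo (2 * alpha) x t
        = a * x t + b * x (t - tau)].

Definition stable (R : realType) (alpha a b c tau : R) : Prop :=
  forall (phi : R -> R) (x1 : R) (x : R -> R),
    {within `[- tau, 0], continuous phi} ->
    is_solution alpha a b c tau phi x1 x ->
    bounded_near (x : R -> R^o) +oo.

Definition unstable (R : realType) (alpha a b c tau : R) : Prop :=
  ~ stable alpha a b c tau.

(* Main.v *)
Require Import Defs.
From HB Require Import structures.
From mathcomp Require Import all_boot all_order all_algebra.
From mathcomp Require Import all_classical all_reals all_analysis.
From mathcomp Require Import measurable_realfun ring lra.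
Import Order.TTheory GRing.Theory Num.Theory.
Import numFieldNormedType.Exports.
Local Open Scope ring_scope.
Local Open Scope classical_set_scope.

(** With [A = -1/c], [z = D^(2 alpha) x] solves the delayed Volterra equation
  [z = A I^alpha z + (a/c) I^(2 alpha) z + (b/c) I^(2 alpha) z(. - tau) + F], where
  [I^beta] is convolution with the Riemann-Liouville kernel [t^(beta-1)/Gamma beta]
  and [F] collects the history.  For [tau < tau_star] the characteristic function is
  negative at [(A/2)^(1/alpha)] and positive at [A^(1/alpha)], so it has a root [l > 0].
  A bounded solution has a Laplace transform at the real point [l]; the Volterra
  equation then forces the Laplace transform of [F] to vanish at [l].  It remains to
  exhibit one solution for which it does not.  The semigroup identity
  [I^a I^b = I^(a+b)] gives its regularity and its Caputo derivatives: [z] is sought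
  as a finite sum of powers [t^(j alpha)] (which absorbs the singularity at [0] when
  [tau = 0], and is empty when [tau > 0] thanks to a compactly supported spline as
  forcing) plus [I^2 w], with [w] given by a Neumann series. *)

(** With x = x0 + I^(2 alpha) z for t > 0 and initial slope 0, the Caputo derivatives are I^alpha z
    and z for every alpha in ]0, 1[. Two obstacles shape the proof. The first is growth: the Neumann
    series only bounds z by a multiple of e^(s t), where s may exceed the root l, so z need not have
    a Laplace transform at l. The Volterra equation is therefore carried by I^(2 alpha) to y = x -
    x0, the function that the assumed boundedness controls, and y is transformed at l. The second is
    regularity: x has to be differentiable for t > 0, twice when 2 alpha > 1, so I^r z must be
    continuous there for every r > -1, negative r standing for derivatives. The two spare
    integrations in I^2 w provide this. The forcing decides which powers occur. If tau = 0 the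
    history is a single value, the forcing is a nonzero constant on t > 0, and its jump at 0
    produces powers of t^alpha. If tau > 0 the history is free on an interval, and a forcing that
    starts at 0 to second order and dies out by time tau can be imposed. *)

(** * Affine changes of variable for integrals over the real line *)

Section affine_substitution.
Context {R : realType}.
Notation mu := (@lebesgue_measure R).
Implicit Types (f : R -> \bar R).

(** By hypothesis [k] times the pushforward of Lebesgue measure along [phi] agrees with Lebesgue
    measure on half-open intervals, hence everywhere by uniqueness. Dilations, translations and
    reflections are instances. *)
Lemma ge0_integral_image (phi : R -> R) (k : {nonneg R}) f :
  measurable_fun setT phi ->
  (forall a b : R, (k%:num%:E * mu (phi @^-1` `]a, b]) = mu `]a, b])%E) ->
  measurable_fun setT f -> (forall x, (0 <= f x)%E) ->
  (\int[mu]_x f x = k%:num%:E * \int[mu]_x f (phi x))%E.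
Proof.
move=> mphi0 muphi mf f0.
have mphi : measurable_fun setT
  (phi : measurableTypeR R -> measurableTypeR R) := mphi0.
have := @ge0_integral_pushforward _ _ _ _ R _ mphi mu setT f measurableT mf
  (fun x _ => f0 x).
rewrite preimage_setT => <-.
pose phi' : {mfun measurableTypeR R >-> measurableTypeR R} :=
  HB.pack phi (isMeasurableFun.Build _ _ _ _ _ mphi).
rewrite -(@ge0_integral_mscale _ (measurableTypeR R) R (pushforward mu phi')) //.
apply: eq_measure_integral => A mA _.
apply: lebesgue_measure_unique => // _ [[a b]] _ <-.
by rewrite -muphi.
Qed.

Lemma ge0_integral_affine (c a : R) f : 0 < c ->
  measurable_fun setT f -> (forall x, (0 <= f x)%E) ->
  (\int[mu]_x f x = c%:E * \int[mu]_x f (c * x + a)%R)%E.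
Proof.
move=> c0 mf f0.
apply: (@ge0_integral_image (fun x => c * x + a) (NngNum (ltW c0))) => //=.
  exact: measurable_funD.
move=> u v.
have -> : (fun x => c * x + a) @^-1` `]u, v] = `](u - a) / c, (v - a) / c]%classic.
  apply/seteqP; split => x /=; rewrite !in_itv/= => /andP[];
  by rewrite !ltr_pdivrMr// !ler_pdivlMr// => ? ?; apply/andP; split; lra.
rewrite !lebesgue_measure_itv/= !lte_fin ltr_pM2r ?invr_gt0// ltrD2r.
case: ifPn => _; last by rewrite mule0.
by rewrite -!EFinB -EFinM; congr (_%:E); field; rewrite gt_eqF.
Qed.

Lemma ge0_integral_shift (a : R) f :
  measurable_fun setT f -> (forall x, (0 <= f x)%E) ->
  (\int[mu]_x f (x + a)%R = \int[mu]_x f x)%E.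
Proof.
move=> mf f0; rewrite [RHS](ge0_integral_affine 1 a)// mul1e.
by apply: eq_integral => x _; rewrite mul1r.
Qed.

Lemma ge0_integral_reflect (a : R) f :
  measurable_fun setT f -> (forall x, (0 <= f x)%E) ->
  (\int[mu]_x f (a - x)%R = \int[mu]_x f x)%E.
Proof.
move=> mf f0.
rewrite [RHS](@ge0_integral_image (fun x => a - x) (NngNum ler01))//=.
- by rewrite mul1e.
- by exact: measurable_funB.
move=> u v; rewrite mul1e.
have -> : (fun x => a - x) @^-1` `]u, v] = `[(a - v), (a - u)[%classic.
  by apply/seteqP; split => x /=; rewrite !in_itv/= => /andP[? ?];
    apply/andP; split; lra.
rewrite !lebesgue_measure_itv/= !lte_fin ltrD2l ltrN2.
by case: ifPn => // _; rewrite -!EFinB; congr (_%:E); ring.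
Qed.

End affine_substitution.

(** * Convergence and positivity of the Gamma integral *)

Section gamma.
Context {R : realType}.
Notation mu := (@lebesgue_measure R).

(** For [b < 1] the integrand blows up at 0: the primitive t^b / b is used on [1/(n+1), 1], and the
    bound passes to the limit by monotone convergence. *)
Lemma integral_powR_itv0c_le (b : R) : 0 < b ->
  (\int[mu]_(t in `]0%R, 1%R]) (t `^ (b - 1))%:E <= (b^-1)%:E)%E.
Proof.
move=> b0.
pose F (n : nat) := `[(n.+1%:R^-1 : R), 1]%classic.
have F0 n x : F n x -> 0 < x.
  by rewrite /F /= in_itv/= => /andP[+ _]; exact: lt_le_trans.
have UF : \bigcup_n F n = `]0, 1]%classic.
  apply/seteqP; split => x /=.
    by case=> n _ Fn; rewrite in_itv/= (F0 _ _ Fn); move: Fn;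
      rewrite /F/= in_itv/= => /andP[].
  rewrite in_itv/= => /andP[x0 x1].
  have := near_infty_natSinv_lt (PosNum x0) => -[n _ /(_ n (leqnn n))] /= nx.
  by exists n => //; rewrite /F/= in_itv/= x1 andbT ltW.
have mF n : measurable (F n) by exact: measurable_itv.
have mp : measurable_fun setT (fun t : R => (t `^ (b - 1))%:E).
  by apply/measurable_EFinP; exact: measurable_powR.
have cF : (\int[mu]_(x in F i) (x `^ (b - 1))%:E @[i --> \oo] -->
     (\int[mu]_(x in `]0%R, 1%R]) (x `^ (b - 1))%:E))%E.
  rewrite -UF; apply: ge0_nondecreasing_set_cvg_integral.
  - apply/nondecreasing_seqP => n; rewrite subsetEset /F => x /=.
    rewrite !in_itv/= => /andP[h ->]; rewrite andbT (le_trans _ h)//.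
    by rewrite lef_pV2 ?posrE// ler_nat.
  - exact: mF.
  - by move=> i; exact: measurable_funTS.
  - by move=> i x _; rewrite lee_fin powR_ge0.
rewrite -(cvg_lim _ cF)//; apply: lime_le; first by apply/cvg_ex; eexists; exact: cF.
near=> n.
have n1 : (n.+1%:R^-1 : R) < 1.
  rewrite invf_lt1// ltr1n ltnS; near: n; exact: nbhs_infty_gt.
have dp (t : R) : 0 < t -> is_derive t 1 (fun t => b^-1 * t `^ b) (t `^ (b - 1)).
  move=> t0; have h := is_derive1_powR b t0.
  have := @is_deriveZ R R^o R^o (fun u => u `^ b) b^-1 t 1 _ h.
  rewrite /GRing.scale/= mulKf//.
  by rewrite gt_eqF.
rewrite (@continuous_FTC2 _ _ (fun t => b^-1 * t `^ b))//.
- rewrite -EFinB lee_fin powR1 mulr1 gerBl// mulr_ge0 ?powR_ge0// invr_ge0 ltW//.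
- apply: derivable_within_continuous => t; rewrite in_itv/= => /andP[t0 _].
  by apply: derivable_powR; rewrite in_itv/= andbT (lt_le_trans _ t0).
- have cp (t : R) : 0 < t -> {for t, continuous (fun t => b^-1 * t `^ b)}.
    move=> /dp [h _]; exact/differentiable_continuous/derivable1_diffP.
  split.
  + move=> t; rewrite in_itv/= => /andP[t0 _].
    have t1 : 0 < t by rewrite (lt_trans _ t0).
    by have [] := dp t t1.
  + by apply: cvg_at_right_filter; exact: cp.
  + by apply: cvg_at_left_filter; exact: cp.
- move=> t; rewrite in_itv/= => /andP[t0 _].
  have t1 : 0 < t by rewrite (lt_trans _ t0).
  by have [_ ?] := dp t t1; rewrite derive1E.
Unshelve. all: by end_near. Qed.

(** With y = s t / p, the bound y <= e^y raised to the power p gives t^p <= (p/s)^p e^(s t). *)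
Lemma powR_le_expR (p s : R) : 0 <= p -> 0 < s ->
  exists C : R, 0 < C /\ forall t, 0 <= t -> t `^ p <= C * expR (s * t).
Proof.
rewrite le_eqVlt => /predU1P[<-|p0] s0.
  exists 1; split => // t t0; rewrite powRr0 mul1r -expR0 ler_expR.
  by rewrite mulr_ge0// ltW.
exists ((p / s) `^ p); split => [|t t0]; first by rewrite powR_gt0// divr_gt0.
have -> : s * t = (s / p * t) * p by field; rewrite gt_eqF.
have sp : 0 < s / p by rewrite divr_gt0.
have ps : 0 < p / s by rewrite divr_gt0.
have y0 : 0 <= s / p * t by rewrite mulr_ge0// ltW.
rewrite expRM -powRM ?expR_ge0 ?(ltW ps)//.
apply: ge0_ler_powR; rewrite ?nnegrE ?(ltW p0)//.
  by rewrite mulr_ge0 ?expR_ge0// ltW.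
have := expR_ge1Dx (s / p * t) => h.
have {1}-> : t = p / s * (s / p * t) by field; rewrite !gt_eqF.
by rewrite ler_pM2l//; lra.
Qed.

Lemma Gamma_finite (b : R) : 0 < b ->
  (\int[mu]_(t in `]0%R, +oo[) (t `^ (b - 1) * expR (- t))%:E < +oo)%E.
Proof.
move=> b0.
have mf : measurable_fun setT (fun t : R => (t `^ (b - 1) * expR (- t))%:E).
  apply/measurable_EFinP; apply: measurable_funM; first exact: measurable_powR.
  exact: measurableT_comp.
have -> : `]0%R, +oo[%classic = `]0%R, 1%R] `|` `]1%R, +oo[ :> set R.
  by rewrite -itv_bndbnd_setU// bnd_simp.
rewrite ge0_integral_setU//=; last 3 first.
- exact: measurable_funTS.
- by move=> x _; rewrite lee_fin mulr_ge0 ?powR_ge0 ?expR_ge0.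
- apply/disj_setPRL => x /=; rewrite !in_itv/= => /andP[x1 _].
  by apply/negP; rewrite negb_and -!leNgt; apply/orP; right; rewrite -ltNge.
apply: lte_add_pinfty.
  apply: le_lt_trans (ltry b^-1); apply: le_trans (integral_powR_itv0c_le b b0).
  apply: ge0_le_integral => //=.
  - by move=> x _; rewrite lee_fin mulr_ge0 ?powR_ge0 ?expR_ge0.
  - exact: measurable_funTS.
  - apply/measurable_EFinP/measurable_funTS; exact: measurable_powR.
  - move=> x; rewrite in_itv/= => /andP[x0 _]; rewrite lee_fin ler_piMr ?powR_ge0//.
    by rewrite -expR0 ler_expR oppr_le0 ltW.
have h2 : (0 : R) < 2^-1 by rewrite invr_gt0.
have [C [C0 hC]] := powR_le_expR (`|b - 1|) 2^-1 (normr_ge0 _) h2.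
(* Half of the exponential absorbs the power. The factor 2 undoes the rate 1/2 in front of the
   exponential density. *)
apply: (@le_lt_trans _ _ (\int[mu]_(t in `]1%R, +oo[) (C * 2 * exponential_pdf 2^-1 t)%:E)%E).
  apply: ge0_le_integral => //=.
  - by move=> x _; rewrite lee_fin mulr_ge0 ?powR_ge0 ?expR_ge0.
  - exact: measurable_funTS.
  - apply/measurable_EFinP/measurable_funTS/measurable_funM => //.
    exact: measurable_exponential_pdf.
  - move=> x; rewrite in_itv/= andbT => x1.
    have x0 : 0 <= x by rewrite (le_trans ler01)// ltW.
    rewrite lee_fin exponential_pdfE//=.
    have -> : expR (- x) = expR (- (2^-1 * x)) * expR (- (2^-1) * x).
      by rewrite -expRD; congr expR; field.
    have -> : forall u, C * 2 * (2^-1 * u) = C * u by move=> u; field.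
    rewrite mulrA ler_pM2r ?expR_gt0// expRN ler_pdivrMr ?expR_gt0//.
    apply: le_trans (hC _ x0); apply: ler_powR; [exact: ltW|exact: ler_norm].
apply: (@le_lt_trans _ _ (\int[mu]_t (C * 2 * exponential_pdf 2^-1 t)%:E)%E).
  apply: ge0_subset_integral => //=.
    apply/measurable_EFinP/measurable_funM => //; exact: measurable_exponential_pdf.
  move=> x _; rewrite lee_fin; apply: mulr_ge0; first by rewrite mulr_ge0// ltW.
  by apply: exponential_pdf_ge0; exact: ltW.
under eq_integral do rewrite EFinM.
rewrite ge0_integralZl//=.
- by rewrite integral_exponential_pdf// mule1 ltry.
- apply/measurable_EFinP; exact: measurable_exponential_pdf.
- by move=> x _; rewrite lee_fin exponential_pdf_ge0// ltW.
- by rewrite lee_fin mulr_ge0// ltW.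
Qed.

Lemma Gamma_gt0 (b : R) : 0 < b -> 0 < Gamma b.
Proof.
move=> b0; have fin := Gamma_finite b b0.
have mf : measurable_fun setT (fun t : R => (t `^ (b - 1) * expR (- t))%:E).
  apply/measurable_EFinP; apply: measurable_funM; first exact: measurable_powR.
  exact: measurableT_comp.
rewrite /Gamma /Rintegral fine_gt0// fin andbT.
(* On [1, 2], b > 0 gives t^(b-1) >= t^(-1) >= 1/2. *)
apply: (@lt_le_trans _ _ (\int[mu]_(t in `[1%R, 2%R]) (cst (2^-1 * expR (-2))%:E t))%E).
  rewrite integral_cst//= lebesgue_measure_itv/= lte_fin ltr1n/= -EFinB -EFinM lte_fin.
  by rewrite !mulr_gt0 ?expR_gt0//; lra.
apply: (@le_trans _ _ (\int[mu]_(t in `[1%R, 2%R]) (t `^ (b - 1) * expR (- t))%:E)%E).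
  apply: ge0_le_integral => //=.
  - exact: measurable_funTS mf.
  - move=> x; rewrite in_itv/= => /andP[x1 x2]; rewrite lee_fin ler_pM ?expR_ge0//.
      apply: (@le_trans _ _ (x `^ (-1))); last by apply: ler_powR => //; lra.
      by rewrite powR_inv1 ?lef_pV2 ?posrE//; lra.
    by rewrite ler_expR; lra.
apply: ge0_subset_integral => //=.
- exact: measurable_funTS.
- by move=> x _; rewrite lee_fin mulr_ge0 ?powR_ge0 ?expR_ge0.
- by move=> x /=; rewrite !in_itv/= andbT => /andP[x1 _]; rewrite (lt_le_trans _ x1).
Qed.

End gamma.

(** * The Riemann-Liouville kernel and its Laplace transform *)

Section kernel.
Context {R : realType}.
Notation mu := (@lebesgue_measure R).

(** Extension by 0 turns the fractional integral from base point 0 into a convolution over the whole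
    line, to which translation invariance and Tonelli apply without moving bounds. For b = 1 it is
    the unit step. *)
Definition rl_kernel (b t : R) : R :=
  if 0 < t then t `^ (b - 1) / Gamma b else 0.

Lemma rl_kernel_ge0 (b t : R) : 0 < b -> 0 <= rl_kernel b t.
Proof.
move=> b0; rewrite /rl_kernel; case: ifP => // _.
by rewrite divr_ge0 ?powR_ge0// ltW// Gamma_gt0.
Qed.

Lemma rl_kernel_le0 (b t : R) : t <= 0 -> rl_kernel b t = 0.
Proof. by move=> t0; rewrite /rl_kernel ltNge t0. Qed.

Lemma rl_kernel_gt0 (b t : R) : 0 < t -> rl_kernel b t = t `^ (b - 1) / Gamma b.
Proof. by move=> t0; rewrite /rl_kernel t0. Qed.

Lemma measurable_rl_kernel (b : R) : measurable_fun setT (rl_kernel b).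
Proof.
apply: measurable_fun_ifT => //; first exact: measurable_fun_ltr.
by apply: measurable_funM => //; exact: measurable_powR.
Qed.

Lemma integral_rl_kernel_expR1 (b : R) : 0 < b ->
  (\int[mu]_t (rl_kernel b t * expR (- t))%:E = 1)%E.
Proof.
move=> b0; have G0 := Gamma_gt0 b b0; have fin := Gamma_finite b b0.
have mf : measurable_fun setT (fun t : R => (t `^ (b - 1) * expR (- t))%:E).
  apply/measurable_EFinP; apply: measurable_funM; first exact: measurable_powR.
  exact: measurableT_comp.
transitivity ((Gamma b)^-1%:E *
    \int[mu]_(t in `]0%R, +oo[) (t `^ (b - 1) * expR (- t))%:E)%E.
  rewrite -ge0_integralZl//=; last 3 first.
  - exact: measurable_funTS.
  - by move=> x _; rewrite lee_fin mulr_ge0 ?powR_ge0 ?expR_ge0.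
  - by rewrite lee_fin invr_ge0 ltW.
  rewrite [RHS]integral_mkcond/=; apply: eq_integral => t _.
  rewrite patchE /rl_kernel; case: ifPn => [t0|t0].
    rewrite mem_set/=; last by rewrite in_itv/= t0.
    by rewrite -EFinM; congr (_%:E); rewrite mulrA [_^-1 * _]mulrC.
  by rewrite memNset/= ?mul0r// in_itv/= andbT; exact/negP.
rewrite -[X in (_ * X)%E]fineK.
  rewrite [fine _](_ : _ = Gamma b)// -EFinM mulVf//.
  by rewrite gt_eqF.
rewrite ge0_fin_numE//.
by apply: integral_ge0 => x _; rewrite lee_fin mulr_ge0 ?powR_ge0 ?expR_ge0.
Qed.

Lemma rl_kernelZ (b c t : R) : 0 < c -> rl_kernel b (c * t) = c `^ (b - 1) * rl_kernel b t.
Proof.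
move=> c0; rewrite /rl_kernel pmulr_rgt0//; case: ifPn => t0; last by rewrite mulr0.
by rewrite powRM ?(ltW c0) ?(ltW t0)// mulrA.
Qed.

Lemma integral_rl_kernel_expR (b l : R) : 0 < b -> 0 < l ->
  (\int[mu]_t (rl_kernel b t * expR (- (l * t)))%:E = (l `^ (- b))%:E)%E.
Proof.
move=> b0 l0.
have mf : measurable_fun setT (fun t => (rl_kernel b t * expR (- (l * t)))%:E).
  apply/measurable_EFinP; apply: measurable_funM; first exact: measurable_rl_kernel.
  by apply: measurableT_comp => //; apply: measurableT_comp => //;
    exact: measurable_funM.
rewrite (@ge0_integral_affine R l^-1 0)//; last 2 first.
- by rewrite invr_gt0.
- by move=> x; rewrite lee_fin mulr_ge0 ?expR_ge0 ?rl_kernel_ge0.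
under eq_integral => t _.
  rewrite addr0 rl_kernelZ ?invr_gt0// mulVKf; last by rewrite gt_eqF.
  rewrite -mulrA EFinM; over.
rewrite ge0_integralZl//=; last 3 first.
- apply/measurable_EFinP; apply: measurable_funM; first exact: measurable_rl_kernel.
  exact: measurableT_comp.
- by move=> x _; rewrite lee_fin mulr_ge0 ?expR_ge0 ?rl_kernel_ge0.
- by rewrite lee_fin powR_ge0.
rewrite integral_rl_kernel_expR1// mule1 -EFinM; congr (_%:E).
rewrite mulr_powRB1 ?invr_ge0 ?(ltW l0)//.
by rewrite -powR_inv1 ?(ltW l0)// -powRrM mulN1r.
Qed.

Lemma measurable_conv_pair (f h : R -> R) :
  measurable_fun setT f -> measurable_fun setT h ->
  measurable_fun setT (fun z : measurableTypeR R * measurableTypeR R =>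
    (f (z.1 - z.2) * h z.2)%:E).
Proof.
move=> mf mh; apply/measurable_EFinP; apply: measurable_funM.
  by apply: measurableT_comp => //; exact: measurable_funB.
exact: measurableT_comp.
Qed.

(** Tonelli after splitting e^(-l t) into e^(-l (t - s)) e^(-l s). The identity lives in the
    extended reals, so it can be used before any finiteness is known. *)
Lemma ge0_integral_conv_expR (f h : R -> R) (l : R) :
  measurable_fun setT f -> measurable_fun setT h ->
  (forall t, 0 <= f t) -> (forall t, 0 <= h t) ->
  (\int[mu]_t (\int[mu]_s (f (t - s) * h s)%:E * (expR (- (l * t)))%:E)
   = (\int[mu]_t (f t * expR (- (l * t)))%:E)
     * (\int[mu]_t (h t * expR (- (l * t)))%:E))%E.
Proof.
move=> mf mh f0 h0.
have me : measurable_fun setT (fun t : R => expR (- (l * t))).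
  by apply: measurableT_comp => //; apply: measurableT_comp => //;
    exact: measurable_funM.
pose F := fun z : measurableTypeR R * measurableTypeR R =>
  (f (z.1 - z.2) * h z.2 * expR (- (l * z.1)))%:E.
have mF : measurable_fun setT F.
  apply/measurable_EFinP; apply: measurable_funM.
    by apply/measurable_EFinP; exact: measurable_conv_pair.
  exact: (measurableT_comp me).
have F0 z : (0 <= F z)%E by rewrite lee_fin !mulr_ge0 ?expR_ge0.
transitivity (\int[mu]_t \int[mu]_s F (t, s))%E.
  apply: eq_integral => t _; rewrite /F/=.
  under [RHS]eq_integral do rewrite EFinM.
  rewrite ge0_integralZr//=.
  - apply/measurable_EFinP; apply: measurable_funM => //.
    by apply: measurableT_comp => //; exact: measurable_funB.
  - by move=> s _; rewrite lee_fin mulr_ge0.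
rewrite fubini_tonelli//.
under eq_integral => s _.
  rewrite /F/=.
  rewrite -(@ge0_integral_shift R s (fun t => (f (t - s) * h s * expR (- (l * t)))%:E)); last 2 first.
  - apply/measurable_EFinP; apply: measurable_funM => //.
    by apply: measurable_funM => //; apply: measurableT_comp => //; exact: measurable_funB.
  - by move=> x; rewrite lee_fin !mulr_ge0 ?expR_ge0.
  under eq_integral => t _.
    rewrite addrK mulrDr opprD expRD mulrACA EFinM; over.
  rewrite ge0_integralZr//=; last 3 first.
  - by apply/measurable_EFinP; exact: measurable_funM.
  - by move=> x _; rewrite lee_fin mulr_ge0 ?expR_ge0.
  - by rewrite lee_fin mulr_ge0 ?expR_ge0.
  over.
rewrite ge0_integralZl//=.
- by apply/measurable_EFinP; exact: measurable_funM.
- by move=> x _; rewrite lee_fin mulr_ge0 ?expR_ge0.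
- by apply: integral_ge0 => x _; rewrite lee_fin mulr_ge0 ?expR_ge0.
Qed.

End kernel.

(** * Fractional integrals: semigroup law of the kernels, and linearity *)

Section semigroup.
Context {R : realType}.
Notation mu := (@lebesgue_measure R).

Lemma measurable_reflect_shift (f : R -> R) (t : R) :
  measurable_fun setT f -> measurable_fun setT (fun s : R => f (t - s)).
Proof. by move=> mf; apply: measurableT_comp => //; exact: measurable_funB. Qed.

Lemma measurable_conv (f h : R -> R) (t : R) :
  measurable_fun setT f -> measurable_fun setT h ->
  measurable_fun setT (fun s : R => (f (t - s) * h s)%:E).
Proof.
move=> mf mh; apply/measurable_EFinP; apply: measurable_funM => //.
exact: measurable_reflect_shift.
Qed.

(** The Beta integral is not computed. By homogeneity the left side is a constant, a priori possibly
    infinite, times t^(a+b-1) for t > 0; comparing Laplace transforms at 1, where every kernel has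
    transform 1, identifies the constant. *)
Lemma rl_kernel_conv (a b t : R) : 0 < a -> 0 < b ->
  (\int[mu]_s (rl_kernel a (t - s) * rl_kernel b s)%:E = (rl_kernel (a + b) t)%:E)%E.
Proof.
move=> a0 b0; have ab0 : 0 < a + b by rewrite addr_gt0.
have mk := @measurable_rl_kernel R.
have k0 (c : R) (c0 : 0 < c) u := rl_kernel_ge0 c u c0.
pose C := (\int[mu]_s (rl_kernel a (1 - s) * rl_kernel b s)%:E)%E.
have C0 : (0 <= C)%E.
  by apply: integral_ge0 => s _; rewrite lee_fin mulr_ge0 ?k0.
have G0 := Gamma_gt0 (a + b) ab0.
have key u : (\int[mu]_s (rl_kernel a (u - s) * rl_kernel b s)%:E =
    (C * (Gamma (a + b))%:E) * (rl_kernel (a + b) u)%:E)%E.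
  have [u0|u0] := leP u 0.
    rewrite rl_kernel_le0// mule0; apply: integral0_eq => s _.
    have [s0|s0] := leP s 0; first by rewrite (rl_kernel_le0 b)// mulr0.
    by rewrite rl_kernel_le0 ?mul0r//; lra.
  rewrite (@ge0_integral_affine R u 0)//; last 2 first.
  - exact: measurable_conv.
  - by move=> s; rewrite lee_fin mulr_ge0 ?k0.
  under eq_integral => s _.
    rewrite addr0 -{1}(mulr1 u) -mulrBr !rl_kernelZ// mulrACA EFinM; over.
  rewrite ge0_integralZl//=; last 3 first.
  - exact: measurable_conv.
  - by move=> s _; rewrite lee_fin mulr_ge0 ?k0.
  - by rewrite lee_fin mulr_ge0 ?powR_ge0.
  rewrite -/C muleA -EFinM muleC -muleA -EFinM; congr (C * _%:E)%E.
  rewrite /rl_kernel u0 [RHS]mulrCA mulfV ?gt_eqF// mulr1.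
  rewrite mulrA mulr_powRB1 ?(ltW u0)// -powRD; first by rewrite addrA.
  by rewrite (gt_eqF u0) implybT.
have := ge0_integral_conv_expR _ _ 1 (mk a) (mk b) (k0 _ a0) (k0 _ b0).
under eq_integral => u _ do rewrite key -muleA -EFinM.
rewrite ge0_integralZl//=; last 3 first.
- apply/measurable_EFinP; apply: measurable_funM; first exact: mk.
  by apply: measurableT_comp => //; apply: measurableT_comp => //;
    exact: measurable_funM.
- by move=> s _; rewrite lee_fin mulr_ge0 ?k0 ?expR_ge0.
- by rewrite mule_ge0// lee_fin ltW.
rewrite !integral_rl_kernel_expR// !powR1 !mule1 => CG.
by rewrite key CG mul1e.
Qed.

Lemma integral_shift (a : R) (f : R -> \bar R) :
  measurable_fun setT f -> (\int[mu]_x f (x + a)%R = \int[mu]_x f x)%E.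
Proof.
move=> mf; rewrite [LHS]integralE [RHS]integralE; congr (_ - _)%E.
  rewrite -[RHS](@ge0_integral_shift _ a)//; last exact: measurable_funepos.
  by apply: eq_integral => x _; rewrite !funeposE.
rewrite -[RHS](@ge0_integral_shift _ a)//; last exact: measurable_funeneg.
by apply: eq_integral => x _; rewrite !funenegE.
Qed.

Definition rl_int (b : R) (f : R -> R) (t : R) : R :=
  \int[mu]_s (rl_kernel b (t - s) * f s).

Definition rl_integrable (b : R) (f : R -> R) (t : R) : Prop :=
  mu.-integrable setT (fun s => (rl_kernel b (t - s) * f s)%:E).

Lemma rl_integrable_kernel (a b t : R) : 0 < a -> 0 < b ->
  rl_integrable a (rl_kernel b) t.
Proof.
move=> a0 b0; apply/integrableP; split.
  by apply: measurable_conv; exact: measurable_rl_kernel.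
under eq_integral do rewrite gee0_abs ?lee_fin ?mulr_ge0 ?rl_kernel_ge0//.
by rewrite rl_kernel_conv// ltry.
Qed.

Lemma rl_int_kernel (a b t : R) : 0 < a -> 0 < b ->
  rl_int a (rl_kernel b) t = rl_kernel (a + b) t.
Proof. by move=> a0 b0; rewrite /rl_int /Rintegral rl_kernel_conv. Qed.

Lemma rl_integrableD (b : R) (f g : R -> R) (t : R) :
  rl_integrable b f t -> rl_integrable b g t ->
  rl_integrable b (fun s => f s + g s) t.
Proof.
move=> hf hg; have := integrableD measurableT hf hg.
by apply: eq_integrable => // s _; rewrite /= -EFinD mulrDr.
Qed.

Lemma rl_integrableZ (b c : R) (f : R -> R) (t : R) :
  rl_integrable b f t -> rl_integrable b (fun s => c * f s) t.
Proof.
move=> hf; have := integrableZl measurableT c hf.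
by apply: eq_integrable => // s _; rewrite /= -EFinM mulrCA.
Qed.

Lemma rl_integrable_sum (b : R) n (f : nat -> R -> R) (t : R) :
  (forall j, rl_integrable b (f j) t) ->
  rl_integrable b (fun s => \sum_(j < n) f j s) t.
Proof.
move=> hf; elim: n => [|n ih].
  apply: (@eq_integrable _ _ _ mu setT measurableT (cst 0%E)) => //.
    by move=> s _; rewrite big_ord0 mulr0.
  exact: integrable0.
have := rl_integrableD b _ _ t ih (hf n).
by apply: eq_integrable => // s _; rewrite big_ord_recr.
Qed.

Lemma rl_intD (b : R) (f g : R -> R) (t : R) :
  rl_integrable b f t -> rl_integrable b g t ->
  rl_int b (fun s => f s + g s) t = rl_int b f t + rl_int b g t.
Proof.
move=> hf hg; rewrite /rl_int -RintegralD//.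
by apply: eq_Rintegral => s _; rewrite mulrDr.
Qed.

Lemma rl_intZ (b c : R) (f : R -> R) (t : R) :
  rl_integrable b f t ->
  rl_int b (fun s => c * f s) t = c * rl_int b f t.
Proof.
move=> hf; rewrite /rl_int -RintegralZl//.
by apply: eq_Rintegral => s _; rewrite mulrCA.
Qed.

Lemma rl_int_sum (b : R) n (f : nat -> R -> R) (t : R) :
  (forall j, rl_integrable b (f j) t) ->
  rl_int b (fun s => \sum_(j < n) f j s) t = \sum_(j < n) rl_int b (f j) t.
Proof.
move=> hf; elim: n => [|n ih].
  rewrite big_ord0 /rl_int; under eq_Rintegral do rewrite big_ord0 mulr0.
  by rewrite Rintegral_cst// mul0r.
rewrite big_ord_recr -ih/= -rl_intD//; last exact: rl_integrable_sum.
by congr rl_int; apply/funext => s; rewrite big_ord_recr.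
Qed.

Lemma rl_int_shift (b d : R) (f : R -> R) (t : R) :
  measurable_fun setT f ->
  rl_int b (fun s => f (s - d)) t = rl_int b f (t - d).
Proof.
move=> mf; rewrite /rl_int /Rintegral; congr fine.
rewrite -(@integral_shift d); last first.
  apply: (measurable_conv (rl_kernel b) (fun s => f (s - d))).
    exact: measurable_rl_kernel.
  by apply: measurableT_comp => //; exact: measurable_funB.
by apply: eq_integral => s _; rewrite addrK opprD addrA addrAC.
Qed.

Lemma rl_int_le0 (b : R) (f : R -> R) (t : R) :
  (forall s, s <= 0 -> f s = 0) -> t <= 0 -> rl_int b f t = 0.
Proof.
move=> f0 t0; rewrite /rl_int -[RHS](mul0r (fine (mu setT))) -Rintegral_cst//.
apply: eq_Rintegral => s _ /=.
have [s0|s0] := leP s 0; first by rewrite f0// mulr0.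
by rewrite rl_kernel_le0 ?mul0r//; lra.
Qed.

End semigroup.

(** * Causal functions of exponential growth *)

Section expdom.
Context {R : realType}.
Notation mu := (@lebesgue_measure R).

Lemma EFin_rl_int (b t : R) (f : R -> R) : rl_integrable b f t ->
  ((rl_int b f t)%:E = \int[mu]_s (rl_kernel b (t - s) * f s)%:E)%E.
Proof. by move=> h; rewrite fineK//; exact: integrable_fin_num. Qed.

(** [C] bounds the sup norm weighted by e^(-s t). In this norm I^b has operator bound s^(-b), which
    becomes small for large [s]: that is the source of the contraction below. *)
Definition exp_dominated (s C : R) (f : R -> R) : Prop :=
  [/\ measurable_fun setT f, forall t, t <= 0 -> f t = 0
    & forall t, `|f t| <= C * expR (s * t)].

Lemma exp_dominatedW (s C s' C' : R) (f : R -> R) :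
  s <= s' -> C <= C' -> 0 <= C' ->
  exp_dominated s C f -> exp_dominated s' C' f.
Proof.
move=> ss CC C0 [mf f0 fC]; split=> // t.
have [t0|t0] := leP t 0; first by rewrite f0// normr0 mulr_ge0 ?expR_ge0.
apply: le_trans (fC t) _; apply: (@le_trans _ _ (C' * expR (s * t))).
  by rewrite ler_pM2r ?expR_gt0.
by rewrite ler_wpM2l// ler_expR ler_pM2r.
Qed.

Lemma exp_dominatedD (s C D : R) (f g : R -> R) :
  exp_dominated s C f -> exp_dominated s D g ->
  exp_dominated s (C + D) (fun t => f t + g t).
Proof.
move=> [mf f0 fC] [mg g0 gD]; split => [|t t0|t].
- exact: measurable_funD.
- by rewrite f0// g0// addr0.
- by rewrite (le_trans (ler_normD _ _))// mulrDl lerD.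
Qed.

Lemma exp_dominatedZ (s C c : R) (f : R -> R) :
  exp_dominated s C f -> exp_dominated s (`|c| * C) (fun t => c * f t).
Proof.
move=> [mf f0 fC]; split => [|t t0|t].
- exact: measurable_funM.
- by rewrite f0// mulr0.
- by rewrite normrM -mulrA ler_wpM2l.
Qed.

Lemma exp_dominated0 (s : R) : exp_dominated s 0 (fun=> 0).
Proof. by split=> // t; rewrite normr0 mul0r. Qed.

Lemma exp_dominated_sum (s : R) n (C : nat -> R) (f : nat -> R -> R) :
  (forall j, exp_dominated s (C j) (f j)) ->
  exp_dominated s (\sum_(j < n) C j) (fun t => \sum_(j < n) f j t).
Proof.
move=> hf; elim: n => [|n ih].
  rewrite big_ord0 [X in exp_dominated _ _ X](_ : _ = fun=> 0).
    exact: exp_dominated0.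
  by apply/funext => t; rewrite big_ord0.
rewrite big_ord_recr [X in exp_dominated _ _ X](_ : _ =
   fun t => \sum_(j < n) f j t + f n t).
  exact: exp_dominatedD.
by apply/funext => t; rewrite big_ord_recr.
Qed.

Lemma exp_dominated_shift (s C d : R) (f : R -> R) :
  0 <= s -> 0 <= C -> 0 <= d -> exp_dominated s C f ->
  exp_dominated s C (fun t => f (t - d)).
Proof.
move=> s0 C0 d0 [mf f0 fC]; split => [|t t0|t].
- by apply: measurableT_comp => //; exact: measurable_funB.
- by rewrite f0//; lra.
- apply: le_trans (fC _) _; rewrite ler_wpM2l// ler_expR ler_wpM2l//; lra.
Qed.

Lemma exp_dominated_ge0 (s C : R) (f : R -> R) : exp_dominated s C f -> 0 <= C.
Proof.
by move=> [_ _ /(_ 0)]; rewrite mulr0 expR0 mulr1; exact: le_trans.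
Qed.

(** Reduces identities that are linear in [f] to the nonnegative case, where Tonelli applies. Both
    parts keep the rate and the constant of [f]; the shape with [-1] fits [rl_intD] and
    [rl_intZ]. *)
Lemma exp_dominated_posneg (s C : R) (f : R -> R) : exp_dominated s C f ->
  exists f1 f2 : R -> R, [/\ f = (fun t => f1 t + (-1) * f2 t),
    exp_dominated s C f1, exp_dominated s C f2,
    (forall t, 0 <= f1 t) & (forall t, 0 <= f2 t)].
Proof.
move=> [mf f0 fC].
exists (fun t => Num.max (f t) 0), (fun t => Num.max (- f t) 0); split.
- apply/funext => t; have [h|h] := leP 0 (f t).
    by rewrite [X in _ + _ * X]max_r ?oppr_le0//; lra.
  by rewrite max_l; lra.
- split => [|t t0|t].
  + exact: measurable_maxr.
  + by rewrite f0// maxxx.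
  + apply: le_trans (fC t); rewrite ger0_norm; last by rewrite le_max lexx orbT.
    by rewrite ge_max ler_norm normr_ge0.
- split => [|t t0|t].
  + by apply: measurable_maxr => //; exact: measurableT_comp.
  + by rewrite f0// oppr0 maxxx.
  + apply: le_trans (fC t); rewrite ger0_norm; last by rewrite le_max lexx orbT.
    by rewrite -normrN ge_max ler_norm normr_ge0.
- by move=> t; rewrite le_max lexx orbT.
- by move=> t; rewrite le_max lexx orbT.
Qed.

Lemma integral_rl_kernel_shift_expR (b s t : R) : 0 < b -> 0 < s ->
  (\int[mu]_u (rl_kernel b (t - u) * expR (s * u))%:E
   = (s `^ (- b) * expR (s * t))%:E)%E.
Proof.
move=> b0 s0; have mk := @measurable_rl_kernel R b.
have me (c : R) : measurable_fun setT (fun u : R => expR (c * u)).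
  by apply: measurableT_comp => //; exact: measurable_funM.
rewrite -(@ge0_integral_reflect R t); last 2 first.
- exact: measurable_conv.
- by move=> u; rewrite lee_fin mulr_ge0 ?expR_ge0// rl_kernel_ge0.
under eq_integral => u _.
  rewrite opprB addrC subrK mulrBr expRD mulrCA EFinM; over.
rewrite ge0_integralZl//=; last 2 first.
- apply/measurable_EFinP; apply: measurable_funM => //.
  by under eq_fun do rewrite -mulNr; exact: me.
- by move=> u _; rewrite lee_fin mulr_ge0 ?expR_ge0// rl_kernel_ge0.
by rewrite integral_rl_kernel_expR// -EFinM mulrC.
Qed.

Lemma le_integral_rl_kernel (b s C t : R) (f : R -> R) : 0 < b -> 0 < s ->
  exp_dominated s C f ->
  (\int[mu]_u `|(rl_kernel b (t - u) * f u)%:E|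
   <= (C * s `^ (- b) * expR (s * t))%:E)%E.
Proof.
move=> b0 s0 fD; have C0 := exp_dominated_ge0 _ _ _ fD.
case: fD => mf _ fC; have mk := @measurable_rl_kernel R b.
have me : measurable_fun setT (fun u : R => expR (s * u)).
  by apply: measurableT_comp => //; exact: measurable_funM.
apply: (@le_trans _ _
    (\int[mu]_u (C%:E * (rl_kernel b (t - u) * expR (s * u))%:E))%E).
  apply: ge0_le_integral => //=.
  - apply/measurable_EFinP; apply: measurableT_comp => //.
    by apply/measurable_EFinP; exact: measurable_conv.
  - by apply: measurable_funeM; exact: measurable_conv.
  - move=> u _; rewrite -EFinM lee_fin normrM ger0_norm ?rl_kernel_ge0//.
    by rewrite mulrCA ler_wpM2l// rl_kernel_ge0.
rewrite ge0_integralZl//=; last 2 first.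
- exact: measurable_conv.
- by move=> u _; rewrite lee_fin mulr_ge0 ?expR_ge0// rl_kernel_ge0.
by rewrite integral_rl_kernel_shift_expR// -EFinM mulrA.
Qed.

Lemma rl_integrable_exp_dominated (b s C t : R) (f : R -> R) : 0 < b -> 0 < s ->
  exp_dominated s C f -> rl_integrable b f t.
Proof.
move=> b0 s0 fD; apply/integrableP; split.
  by apply: measurable_conv; [exact: measurable_rl_kernel|case: fD].
exact: le_lt_trans (le_integral_rl_kernel b s C t f b0 s0 fD) (ltry _).
Qed.

(** The factor s^(-b) is the Laplace transform of the kernel at [s]. Measurability in t is the
    Tonelli statement for the positive and negative parts. *)
Lemma rl_int_exp_dominated (b s C : R) (f : R -> R) : 0 < b -> 0 < s ->
  exp_dominated s C f -> exp_dominated s (C * s `^ (- b)) (rl_int b f).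
Proof.
move=> b0 s0 fD; have mk := @measurable_rl_kernel R b.
split.
- have [f1 [f2 [ef f1D f2D f10 f20]]] := exp_dominated_posneg _ _ _ fD.
  have mp g : exp_dominated s C g -> (forall t, 0 <= g t) ->
      measurable_fun setT (rl_int b g).
    move=> [mg _ _] g0; rewrite /rl_int /Rintegral.
    apply: (@measurableT_comp _ _ _ _ _ _ fine) => //.
    apply: (measurable_fun_fubini_tonelli_F (m2 := mu)
      (fun z : measurableTypeR R * measurableTypeR R =>
      (rl_kernel b (z.1 - z.2) * g z.2)%:E)).
      exact: measurable_conv_pair.
    by move=> z; rewrite lee_fin mulr_ge0// rl_kernel_ge0.
  rewrite [rl_int b f](_ : _ = fun t => rl_int b f1 t + (-1) * rl_int b f2 t).
    apply: measurable_funD; first exact: mp.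
    by apply: measurable_funM => //; exact: mp.
  apply/funext => t; rewrite ef rl_intD ?rl_intZ//.
  + exact: rl_integrable_exp_dominated f2D.
  + exact: rl_integrable_exp_dominated f1D.
  + by apply: rl_integrableZ; exact: rl_integrable_exp_dominated f2D.
- by case: fD => _ f0 _ t t0; exact: rl_int_le0.
- move=> t; have h := rl_integrable_exp_dominated b s C t f b0 s0 fD.
  rewrite -lee_fin; apply: le_trans (le_integral_rl_kernel b s C t f b0 s0 fD).
  rewrite EFin_normr_Rintegral//; apply: le_abse_integral => //.
  by case/integrableP : h.
Qed.

(** For nonnegative [f], exchanging the integrals leaves the convolution of two kernels; the general
    case follows by the decomposition into parts. *)
Lemma rl_int_rl_int (a b s C t : R) (f : R -> R) : 0 < a -> 0 < b -> 0 < s ->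
  exp_dominated s C f -> rl_int a (rl_int b f) t = rl_int (a + b) f t.
Proof.
move=> a0 b0 s0 fD; have ab0 : 0 < a + b by rewrite addr_gt0.
have mk := @measurable_rl_kernel R.
have int c g u (c0 : 0 < c) (gD : exp_dominated s C g) :=
  rl_integrable_exp_dominated c s C u g c0 s0 gD.
have intb g u gD : rl_integrable a (rl_int b g) u :=
  rl_integrable_exp_dominated _ _ _ _ _ a0 s0
    (rl_int_exp_dominated b s C g b0 s0 gD).
have pos g : exp_dominated s C g -> (forall u, 0 <= g u) ->
    rl_int a (rl_int b g) t = rl_int (a + b) g t.
  move=> gD g0; have mg : measurable_fun setT g by case: gD.
  rewrite {1}/rl_int /Rintegral; congr fine.
  pose F := fun z : measurableTypeR R * measurableTypeR R =>
    (rl_kernel a (t - z.1) * (rl_kernel b (z.1 - z.2) * g z.2))%:E.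
  have mF : measurable_fun setT F.
    apply/measurable_EFinP; apply: measurable_funM.
      apply: measurableT_comp; first exact: mk.
      exact: measurable_funB.
    by apply/measurable_EFinP; exact: measurable_conv_pair.
  have F0 z : (0 <= F z)%E by rewrite lee_fin !mulr_ge0// rl_kernel_ge0.
  transitivity (\int[mu]_u \int[mu]_v F (u, v))%E.
    apply: eq_integral => u _; rewrite /F/= EFinM EFin_rl_int; last exact: int.
    rewrite -ge0_integralZl//.
    - exact: measurable_conv.
    - by move=> v _; rewrite lee_fin mulr_ge0// rl_kernel_ge0.
    - by rewrite lee_fin rl_kernel_ge0.
  rewrite fubini_tonelli//; apply: eq_integral => v _.
  rewrite -(@ge0_integral_shift R v); last 2 first.
  - apply: (measurable_conv (rl_kernel a) (fun u => rl_kernel b (u - v) * g v)) => //.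
    apply: measurable_funM; last exact: measurable_cst.
    by apply: measurableT_comp; [exact: mk|exact: measurable_funB].
  - by move=> u; exact: (F0 (u, v)).
  under eq_integral => u _.
    rewrite /F/= addrK opprD addrA addrAC mulrA EFinM; over.
  rewrite ge0_integralZr//=; last 3 first.
  - by apply: measurable_conv; exact: mk.
  - by move=> u _; rewrite lee_fin mulr_ge0// rl_kernel_ge0.
  - by rewrite lee_fin.
  by rewrite rl_kernel_conv.
have [f1 [f2 [ef f1D f2D f10 f20]]] := exp_dominated_posneg _ _ _ fD.
have -> : rl_int b f = fun u => rl_int b f1 u + (-1) * rl_int b f2 u.
  apply/funext => u; rewrite {1}ef rl_intD ?rl_intZ//; try exact: int.
  by apply: rl_integrableZ; exact: int.
rewrite rl_intD; [|exact: intb|by apply: rl_integrableZ; exact: intb].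
rewrite rl_intZ; last exact: intb.
rewrite !pos// {1}ef rl_intD; [|exact: int|by apply: rl_integrableZ; exact: int].
by rewrite rl_intZ//; exact: int.
Qed.

End expdom.

(** * From whole-line convolutions to integrals over intervals; continuity and differentiability *)

Section interval_form.
Context {R : realType}.
Notation mu := (@lebesgue_measure R).

Lemma Gamma1 : Gamma (1 : R) = 1.
Proof.
have h := @integral_exponential_pdf R 1 ltr01.
apply: EFin_inj; rewrite -h /Gamma /Rintegral fineK; last first.
  rewrite ge0_fin_numE; first exact: Gamma_finite.
  by apply: integral_ge0 => x _; rewrite lee_fin mulr_ge0 ?powR_ge0 ?expR_ge0.
rewrite integral_itv_obnd_cbnd; last first.
  apply/measurable_EFinP/measurable_funTS/measurable_funM.
    exact: measurable_powR.
  exact: measurableT_comp.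
rewrite integral_mkcond; apply: eq_integral => t _; rewrite patchE.
case: ifPn => [|/negP]; rewrite inE/= in_itv/= andbT => t0.
  by rewrite subrr powRr0 mul1r exponential_pdfE//= mulN1r mul1r.
by rewrite lt0_exponential_pdf// ltNge; apply/negP.
Qed.

(** Bridge to the integrals in the definitions. [k] has to match [h] only in the open interval: at
    the endpoints the total derivative and the total power may take meaningless values, on a null
    set. *)
Lemma rl_int_itv (b a t : R) (h k : R -> R) : 0 < b -> a <= 0 ->
  (forall s, s <= 0 -> h s = 0) ->
  (forall s, a < s < t -> k s = h s) ->
  rl_integrable b h t ->
  mu.-integrable `[a, t] (fun s => ((t - s) `^ (b - 1) * k s)%:E) /\
  \int[mu]_(s in `[a, t]) ((t - s) `^ (b - 1) * k s) = Gamma b * rl_int b h t.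
Proof.
move=> b0 a0 h0 kh hi; have G0 := Gamma_gt0 b b0.
pose G (s : R) := Gamma b * (rl_kernel b (t - s) * h s).
have iG : mu.-integrable setT (EFin \o G).
  have := integrableZl measurableT (Gamma b) hi.
  by apply: eq_integrable => // s _; rewrite /= EFinM.
have mG : measurable_fun setT (EFin \o G) by case/integrableP : iG.
have kG s : `]a, t[%classic s -> ((t - s) `^ (b - 1) * k s) = G s.
  rewrite /= in_itv/= => /andP[sa st].
  rewrite /G /rl_kernel subr_gt0 st kh ?sa// mulrA; congr (_ * _).
  by rewrite mulrCA mulfV ?gt_eqF// mulr1.
have Gn s : ~ `]a, t[%classic s -> G s = 0.
  move=> /negP; rewrite /= in_itv/= negb_and -!leNgt => /orP[sa|ts].
    by rewrite /G h0 ?mulr0// (le_trans sa).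
  by rewrite /G rl_kernel_le0 ?mul0r ?mulr0// subr_le0.
have mo : measurable_fun `]a, t[ (fun s => ((t - s) `^ (b - 1) * k s)%:E).
  apply: (@eq_measurable_fun _ _ _ _ _ (EFin \o G)).
    by move=> s /[!inE] st /=; rewrite kG.
  exact: measurable_funTS.
(* Taken below with [abse] for integrability and with [id] for the value, so one computation serves
   both. *)
have intoo (f g : \bar R -> \bar R) : f 0%E = 0%E -> f = g ->
   measurable_fun setT f ->
   (\int[mu]_(s in `[a, t]) f ((t - s) `^ (b - 1) * k s)%:E =
    \int[mu]_s f (G s)%:E)%E.
  move=> f0 _ mf; rewrite integral_itv_bndoo; last exact: measurableT_comp mo.
  rewrite integral_mkcond; apply: eq_integral => s _; rewrite patchE.
  case: ifPn => [|/negP]; rewrite inE => st; first by rewrite kG.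
  by rewrite Gn.
split.
  apply/integrableP; split.
    exact: (@emeasurable_fun_itv_cc _ a t false true).
  rewrite (intoo abse abse)//; first by case/integrableP : iG.
  by rewrite abse0.
rewrite /Rintegral (intoo id id)// -/(Rintegral mu setT G).
by rewrite /G RintegralZl.
Qed.

Lemma rl_int1_itv (a t : R) (h : R -> R) : a <= 0 ->
  (forall s, s <= 0 -> h s = 0) -> rl_integrable 1 h t ->
  mu.-integrable `[a, t] (EFin \o h) /\ \int[mu]_(s in `[a, t]) h s = rl_int 1 h t.
Proof.
move=> a0 h0 hi.
have [] := rl_int_itv 1 a t h h ltr01 a0 h0 (fun _ _ => erefl) hi.
rewrite Gamma1 mul1r => hI <-; split.
  by apply: eq_integrable hI => // s _; rewrite /= subrr powRr0 mul1r.
by apply: eq_Rintegral => s _; rewrite subrr powRr0 mul1r.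
Qed.

Lemma rl_int1_continuous (h : R -> R) :
  (forall s, s <= 0 -> h s = 0) -> (forall t, rl_integrable 1 h t) ->
  continuous (rl_int 1 h).
Proof.
move=> h0 hi t.
(* Every lower bound [a <= 0] gives the same integral; this one places [t], whatever its sign,
   inside the interval. *)
pose a := - (`|t| + 1); pose u := `|t| + 1.
have au : a <= t <= u.
  by rewrite -ler_norml /u (le_trans (ler_norm _))// normr_id lerDl.
have a0 : a <= 0 by rewrite /a oppr_le0 addr_ge0.
have n1 : `|t| < u by rewrite /u ltrDl.
have atu : a < t < u by move: n1; rewrite ltr_norml.
have -> : rl_int 1 h = (fun x => parameterized_integral mu a x h).
  apply/funext => x; rewrite /parameterized_integral.
  by have [_ ->] := rl_int1_itv a x h a0 h0 (hi x).
apply: (@within_continuous_continuous _ _ _ a u).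
- by case/andP: atu => h1 h2; exact: (lt_trans h1 h2).
- apply: parameterized_integral_continuous.
    by case/andP: au => h1 h2; exact: (le_trans h1 h2).
  by have [] := rl_int1_itv a u h a0 h0 (hi u).
- by rewrite in_itv.
Qed.

Lemma rl_int1_derivable (h : R -> R) (t : R) :
  (forall s, s <= 0 -> h s = 0) -> (forall t, rl_integrable 1 h t) ->
  0 < t -> {for t, continuous h} ->
  derivable (rl_int 1 h) t 1 /\ derive1 (rl_int 1 h) t = h t.
Proof.
move=> h0 hi t0 ch.
have -> : rl_int 1 h = (fun x => \int[mu]_(s in `[0, x]) h s).
  by apply/funext => x; have [_ ->] := rl_int1_itv 0 x h (lexx 0) h0 (hi x).
apply: (@continuous_FTC1_closed _ _ _ _ (t + 1)) => //; first by rewrite ltrDl.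
by have [] := rl_int1_itv 0 (t + 1) h (lexx 0) h0 (hi (t + 1)).
Qed.

Lemma rl_kernel_continuous (b t : R) : 0 < t -> {for t, continuous (rl_kernel b)}.
Proof.
move=> t0; rewrite /prop_for /continuous_at {2}/rl_kernel t0.
apply: (@cvg_trans _ ((fun u => u `^ (b - 1) / Gamma b) @ t)).
  apply: near_eq_cvg; near=> u; rewrite /rl_kernel ifT//; near: u.
  exact: lt_nbhsr.
apply: (@continuousM _ R^o (fun u : R => u `^ (b - 1)) (fun=> (Gamma b)^-1) t);
  last exact: cst_continuous.
apply/differentiable_continuous/derivable1_diffP.
by apply: derivable_powR; rewrite in_itv/= andbT.
Unshelve. all: by end_near. Qed.

End interval_form.

(** * The Laplace transform at a real point *)

Section laplace.
Context {R : realType}.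
Notation mu := (@lebesgue_measure R).

Definition laplace (l : R) (f : R -> R) : R := \int[mu]_t (f t * expR (- (l * t))).

Lemma measurable_expRM (c : R) : measurable_fun setT (fun t : R => expR (- (c * t))).
Proof.
by apply: measurableT_comp => //; apply: measurableT_comp => //; apply: measurable_funM.
Qed.

Lemma laplace_integrable (s C l : R) (f : R -> R) : s < l ->
  exp_dominated s C f -> mu.-integrable setT (fun t => (f t * expR (- (l * t)))%:E).
Proof.
move=> sl fD; have C0 := exp_dominated_ge0 _ _ _ fD; case: fD => mf f0 fC.
have ls : 0 < l - s by rewrite subr_gt0.
apply/integrableP; split.
  apply/measurable_EFinP; apply: measurable_funM => //; exact: measurable_expRM.
(* [rl_kernel 1] is the unit step, so the majorant is [C] times the transform of the step at
   [l - s]. *)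
apply: (@le_lt_trans _ _
    (\int[mu]_t (C%:E * (rl_kernel 1 t * expR (- ((l - s) * t)))%:E))%E).
  apply: ge0_le_integral => //=.
  - apply/measurable_EFinP/measurableT_comp => //.
    by apply: measurable_funM => //; exact: measurable_expRM.
  - apply: measurable_funeM; apply/measurable_EFinP.
    by apply: measurable_funM; [exact: measurable_rl_kernel|exact: measurable_expRM].
  - move=> t _; rewrite -EFinM lee_fin normrM (ger0_norm (expR_ge0 _)).
    have [t0|t0] := leP t 0.
      by rewrite f0// normr0 mul0r !mulr_ge0 ?expR_ge0 ?rl_kernel_ge0.
    rewrite /rl_kernel t0 subrr powRr0 Gamma1 divr1 mul1r.
    have -> : expR (- ((l - s) * t)) = expR (s * t) * expR (- (l * t)).
      by rewrite -expRD; congr expR; ring.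
    by rewrite mulrA ler_pM2r ?expR_gt0.
rewrite ge0_integralZl//=; last 2 first.
- apply/measurable_EFinP.
  by apply: measurable_funM; [exact: measurable_rl_kernel|exact: measurable_expRM].
- by move=> t _; rewrite lee_fin mulr_ge0 ?expR_ge0 ?rl_kernel_ge0.
by rewrite integral_rl_kernel_expR// -EFinM ltry.
Qed.

Lemma laplaceD (s C D l : R) (f g : R -> R) : s < l ->
  exp_dominated s C f -> exp_dominated s D g ->
  laplace l (fun t => f t + g t) = laplace l f + laplace l g.
Proof.
move=> sl fD gD; rewrite /laplace -RintegralD//.
- by apply: eq_Rintegral => t _; rewrite mulrDl.
- exact: laplace_integrable sl fD.
- exact: laplace_integrable sl gD.
Qed.

Lemma laplaceZ (s C c l : R) (f : R -> R) : s < l ->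
  exp_dominated s C f -> laplace l (fun t => c * f t) = c * laplace l f.
Proof.
move=> sl fD; rewrite /laplace -RintegralZl//.
- by apply: eq_Rintegral => t _; rewrite mulrA.
- exact: laplace_integrable sl fD.
Qed.

Lemma laplace_shift (l d : R) (f : R -> R) : measurable_fun setT f ->
  mu.-integrable setT (fun t => (f t * expR (- (l * t)))%:E) ->
  laplace l (fun t => f (t - d)) = expR (- (l * d)) * laplace l f.
Proof.
move=> mf fi; rewrite /laplace -RintegralZl// /Rintegral; congr fine.
rewrite -(@integral_shift _ d); last first.
  apply/measurable_EFinP; apply: measurable_funM; last exact: measurable_expRM.
  by apply: measurableT_comp => //; exact: measurable_funB.
apply: eq_integral => t _; congr (_%:E).
by rewrite addrK mulrDr opprD expRD; ring.
Qed.

Lemma laplace_rl_kernel (b l : R) : 0 < b -> 0 < l ->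
  laplace l (rl_kernel b) = l `^ (- b).
Proof. by move=> b0 l0; rewrite /laplace /Rintegral integral_rl_kernel_expR. Qed.

Lemma laplace_rl_int (b s C l : R) (f : R -> R) : 0 < b -> 0 < s -> s < l ->
  exp_dominated s C f -> laplace l (rl_int b f) = l `^ (- b) * laplace l f.
Proof.
move=> b0 s0 sl fD; have l0 : 0 < l := lt_trans s0 sl.
have [f1 [f2 [-> f1D f2D f10 f20]]] := exp_dominated_posneg _ _ _ fD.
have int g u (gD : exp_dominated s C g) :=
  rl_integrable_exp_dominated b s C u g b0 s0 gD.
have pos g : exp_dominated s C g -> (forall u, 0 <= g u) ->
    laplace l (rl_int b g) = l `^ (- b) * laplace l g.
  move=> gD g0; have mg : measurable_fun setT g by case: gD.
  have h := ge0_integral_conv_expR _ _ l (measurable_rl_kernel b) mg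
    (fun t => rl_kernel_ge0 b t b0) g0.
  rewrite /laplace {1}/Rintegral.
  rewrite [X in fine X = _](_ : _ = \int[mu]_t
      (\int[mu]_s (rl_kernel b (t - s) * g s)%:E * (expR (- (l * t)))%:E))%E; last first.
    by apply: eq_integral => t _; rewrite EFinM EFin_rl_int//; exact: int.
  rewrite h integral_rl_kernel_expR// fineM//.
  by apply: integrable_fin_num => //; exact: laplace_integrable sl gD.
have -> : rl_int b (fun t => f1 t + -1 * f2 t) =
    fun t => rl_int b f1 t + (-1) * rl_int b f2 t.
  apply/funext => u; rewrite rl_intD ?rl_intZ//; try exact: int.
  by apply: rl_integrableZ; exact: int.
have I1 := rl_int_exp_dominated b s C f1 b0 s0 f1D.
have I2 := rl_int_exp_dominated b s C f2 b0 s0 f2D.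
rewrite (laplaceD _ _ _ _ _ _ sl I1 (exp_dominatedZ _ _ (-1) _ I2)).
rewrite (laplaceZ _ _ _ _ _ sl I2).
rewrite (laplaceD _ _ _ _ _ _ sl f1D (exp_dominatedZ _ _ (-1) _ f2D)).
by rewrite (laplaceZ _ _ _ _ _ sl f2D) !pos//; ring.
Qed.

(** For b < 1 the kernel is unbounded near 0 and no constant works. This is why the remainders fed
    to the Neumann series have order at least 1. *)
Lemma rl_kernel_exp_dominated (b s : R) : 1 <= b -> 0 < s ->
  exists C, exp_dominated s C (rl_kernel b).
Proof.
move=> b1 s0; have b0 : 0 < b := lt_le_trans ltr01 b1.
have G0 := Gamma_gt0 b b0.
have [C [C0 hC]] := @powR_le_expR R (b - 1) s ltac:(lra) s0.
exists (C / Gamma b); split => [|t t0|t].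
- exact: measurable_rl_kernel.
- exact: rl_kernel_le0.
- rewrite ger0_norm ?rl_kernel_ge0// /rl_kernel; case: ifPn => t0; last first.
    by rewrite mulr_ge0 ?expR_ge0// divr_ge0// ltW.
  by rewrite mulrAC ler_pM2r ?invr_gt0// hC// ltW.
Qed.

End laplace.

(** * Neumann series for the delayed Volterra equation *)

Section neumann.
Context {R : realType}.

(** The sum of the iterates of [L] on [f] is taken pointwise. The tail [w - S n] is itself dominated
    at rate [s], so the contraction hypothesis applies to it and yields [L (S n) t --> L w t]; no
    completeness of a function space enters. *)
Lemma neumann_series (s q C : R) (L : (R -> R) -> R -> R) (f : R -> R) :
  0 <= q -> q < 1 ->
  (forall M g, exp_dominated s M g -> exp_dominated s (q * M) (L g)) ->
  (forall M N g h, exp_dominated s M g -> exp_dominated s N h ->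
    forall t, L (fun u => g u + h u) t = L g t + L h t) ->
  exp_dominated s C f ->
  exists M w, exp_dominated s M w /\ forall t, w t = f t + L w t.
Proof.
move=> q0 q1 Ldom LD fD; have C0 := exp_dominated_ge0 _ _ _ fD.
have q1' : 0 < 1 - q by rewrite subr_gt0.
pose u n := iter n L f.
have uD n : exp_dominated s (q ^+ n * C) (u n).
  elim: n => [|n ih]; first by rewrite expr0 mul1r.
  by rewrite exprS -mulrA; exact: Ldom.
pose S n t := \sum_(k < n) u k t.
have SD n : exp_dominated s (\sum_(k < n) (q ^+ k * C)) (S n).
  exact: (exp_dominated_sum s n (fun k => q ^+ k * C) u uD).
have SS n t : S n.+1 t = S n t + u n t by rewrite /S big_ord_recr.
have SL n t : S n.+1 t = f t + L (S n) t.
  elim: n t => [|n ih] t.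
    (* [S 0] is dominated with constant 0, hence so is its image under [L], which therefore
       vanishes. *)
    rewrite SS {1}/S big_ord0 add0r; rewrite [L _ t](_ : _ = 0) ?addr0//.
    have := Ldom _ _ (SD 0); rewrite big_ord0 mulr0 => -[_ _ /(_ t)].
    by rewrite mul0r normr_le0 => /eqP.
  rewrite SS ih (_ : u n.+1 t = L (u n) t)//.
  rewrite (_ : S n.+1 = fun t => S n t + u n t); last by apply/funext => v; exact: SS.
  by rewrite (LD _ _ _ _ (SD n) (uD n)) addrA.
(* The tail of the majorizing geometric series, bounding every later difference at once. *)
pose T n t := C * expR (s * t) * q ^+ n / (1 - q).
have Sb n k t : `|S (n + k)%N t - S n t| <= T n t * (1 - q ^+ k).
  elim: k => [|k ih]; first by rewrite addn0 subrr normr0 expr0 subrr mulr0.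
  rewrite addnS SS addrAC (le_trans (ler_normD _ _))//.
  have -> : T n t * (1 - q ^+ k.+1) =
      T n t * (1 - q ^+ k) + q ^+ (n + k) * C * expR (s * t).
    rewrite /T exprD exprS; field; by rewrite gt_eqF.
  by rewrite lerD//; case: (uD (n + k)%N).
have T0 n t : 0 <= T n t.
  by rewrite /T divr_ge0 ?mulr_ge0 ?expR_ge0 ?exprn_ge0// ltW.
have Sb' n k t : `|S (n + k)%N t - S n t| <= T n t.
  apply: le_trans (Sb n k t) _; rewrite ler_piMr// lerBlDr lerDl exprn_ge0//.
have cS t : cvgn (fun n => S n t).
  rewrite (_ : (fun n => S n t) = series (fun n => u n t)); last first.
    by apply/funext => n; rewrite seriesEord.
  apply: normed_cvg.
  apply: (@series_le_cvg _ _ (geometric (C * expR (s * t)) q)) => [n|n|n|].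
  - exact: normr_ge0.
  - by rewrite /geometric/= mulr_ge0 ?mulr_ge0 ?expR_ge0 ?exprn_ge0.
  - case: (uD n) => _ _ /(_ t); rewrite /geometric/= => h.
    by rewrite (le_trans h)// le_eqVlt; apply/orP; left; apply/eqP; ring.
  - by apply: is_cvg_geometric_series; rewrite ger0_norm.
pose w t := limn (fun n => S n t).
have wS n t : `|w t - S n t| <= T n t.
  rewrite ler_distl; apply/andP; split.
    apply: limr_ge; first exact: cS.
    exists n => // m /= nm; have := Sb' n (m - n)%N t.
    by rewrite subnKC// ler_distl => /andP[].
  apply: limr_le; first exact: cS.
  exists n => // m /= nm; have := Sb' n (m - n)%N t.
  by rewrite subnKC// ler_distl => /andP[].
have mw : measurable_fun setT w.
  apply: (@measurable_fun_cvg _ _ _ _ S); first by move=> m; case: (SD m).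
  by move=> t _; exact: cS.
have wD : exp_dominated s (C / (1 - q)) w.
  split=> [//|t t0|t].
    rewrite /w (_ : (fun n => S n t) = cst 0) ?lim_cst//.
    by apply/funext => n; case: (SD n) => _ ->.
  have := wS 0 t; rewrite {1}/S big_ord0 subr0 /T expr0 mulr1 => h.
  by rewrite (le_trans h)// mulrAC.
have wSD n : exp_dominated s (C * q ^+ n / (1 - q)) (fun t => w t - S n t).
  split.
  - by apply: measurable_funB => //; case: (SD n).
  - by move=> t t0; case: wD => _ -> //; case: (SD n) => _ -> //; rewrite subrr.
  - move=> t; apply: le_trans (wS n t) _; rewrite /T le_eqVlt; apply/orP; left.
    by apply/eqP; ring.
exists (C / (1 - q)), w; split => // t.
apply/eqP; rewrite -subr_eq0 -normr_le0.
have bound n : `|w t - (f t + L w t)| <= 2 * T n t.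
  have -> : w t - (f t + L w t) = (w t - S n.+1 t) - L (fun v => w v - S n v) t.
    rewrite SL (_ : L w t = L (S n) t + L (fun v => w v - S n v) t); first by ring.
    rewrite -(LD _ _ _ _ (SD n) (wSD n)); congr (L _ t).
    by apply/funext => v; rewrite subrKC.
  rewrite (le_trans (ler_normB _ _))// mulr2n mulrDl mul1r lerD//.
    apply: le_trans (wS n.+1 t) _; rewrite /T exprS ler_pM2r ?invr_gt0//.
    rewrite ler_wpM2l ?mulr_ge0 ?expR_ge0//.
    by rewrite ler_piMl ?exprn_ge0// ltW.
  case: (Ldom _ _ (wSD n)) => _ _ /(_ t) h; apply: le_trans h _.
  rewrite (_ : _ * _ = q * T n t); last by rewrite /T; ring.
  by rewrite ler_piMl// ltW.
have cT : (fun n => 2 * T n t) @ \oo --> (0 : R).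
  rewrite (_ : (fun n => _) = geometric (2 * (C * expR (s * t) / (1 - q))) q); last first.
    by apply/funext => n; rewrite /T /geometric/=; ring.
  by apply: cvg_geometric; rewrite ger0_norm.
rewrite -(cvg_lim _ cT)//; apply: limr_ge; first by apply/cvg_ex; exists 0.
by exists 0%N => // n _; exact: bound.
Qed.

Lemma delay_volterra_solution (al A D B tau s0 C : R) (f : R -> R) :
  0 < al -> 0 <= tau -> 0 < s0 -> exp_dominated s0 C f ->
  exists s M w, [/\ 0 < s, exp_dominated s M w & forall t, w t = f t +
    (A * rl_int al w t + D * rl_int (2 * al) w t + B * rl_int (2 * al) w (t - tau))].
Proof.
move=> al0 tau0 s00 fD; have al20 : 0 < 2 * al by rewrite mulr_gt0.
(* The choice s^al = 2 K with K >= 1 gives s^(-2 al) <= s^(-al) = 1/(2 K), so the three terms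
   together contract by 1/2; delaying does not increase the norm. The summand s0^al ensures s0 <= s,
   so [f] stays dominated at rate s. *)
pose K := `|A| + `|D| + `|B| + 1 + s0 `^ al.
have K1 : 1 <= K.
  by rewrite /K -addrA addrC -addrA lerDl !addr_ge0// powR_ge0.
have K0 : 0 < K := lt_le_trans ltr01 K1.
pose s := (2 * K) `^ (al^-1).
have sal : s `^ al = 2 * K.
  by rewrite /s -powRrM mulVf ?gt_eqF// powRr1// mulr_ge0// ltW.
have s_gt0 : 0 < s by rewrite powR_gt0// mulr_gt0.
have s0s : s0 <= s.
  rewrite leNgt; apply/negP => ss0.
  have : s `^ al <= s0 `^ al.
    by apply: ge0_ler_powR; rewrite ?nnegrE ltW.
  rewrite sal; have : s0 `^ al <= K by rewrite /K lerDr !addr_ge0.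
  by move=> ? ?; lra.
have q2 : s `^ (- (2 * al)) <= (2 * K)^-1.
  rewrite powRN (mulrC 2) powRrM sal lef_pV2 ?posrE ?powR_gt0 ?mulr_gt0//.
  by rewrite le1r_powR; lra.
have q1 : s `^ (- al) = (2 * K)^-1 by rewrite powRN sal.
pose L (g : R -> R) t :=
  A * rl_int al g t + D * rl_int (2 * al) g t + B * rl_int (2 * al) g (t - tau).
have C0 := exp_dominated_ge0 _ _ _ fD.
have fD' : exp_dominated s C f by exact: exp_dominatedW fD.
have [] := @neumann_series s (2^-1) C L f _ _ _ _ fD'.
- by [].
- by rewrite invf_lt1// ltr1n.
- move=> M g gD; have M0 := exp_dominated_ge0 _ _ _ gD.
  have I1 := rl_int_exp_dominated _ _ _ _ al0 s_gt0 gD.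
  have I2 := rl_int_exp_dominated _ _ _ _ al20 s_gt0 gD.
  have I3 := exp_dominated_shift _ _ tau _ (ltW s_gt0) (exp_dominated_ge0 _ _ _ I2) tau0 I2.
  have := exp_dominatedD _ _ _ _ _ (exp_dominatedD _ _ _ _ _
    (exp_dominatedZ _ _ A _ I1) (exp_dominatedZ _ _ D _ I2)) (exp_dominatedZ _ _ B _ I3).
  apply: exp_dominatedW => //; last by rewrite mulr_ge0.
  rewrite q1.
  apply: (@le_trans _ _ ((`|A| + `|D| + `|B|) * (M * (2 * K)^-1))).
    rewrite [leRHS]mulrDl [X in _ <= X + _]mulrDl; apply: lerD; [apply: lerD => //|];
      by apply: ler_wpM2l => //; exact: ler_wpM2l.
  rewrite mulrCA [leRHS]mulrC ler_wpM2l// invfM mulrCA ler_piMr// ler_pdivrMr// mul1r.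
  by rewrite /K -[leRHS]addrA lerDl addr_ge0// powR_ge0.
- move=> M N g h gD hD t; rewrite /L.
  have int b g' M' u (b0 : 0 < b) (gD' : exp_dominated s M' g') :=
    rl_integrable_exp_dominated b s M' u g' b0 s_gt0 gD'.
  have D1 b u (b0 : 0 < b) := rl_intD b g h u (int b g M u b0 gD) (int b h N u b0 hD).
  rewrite !D1//; move: (rl_int al g t) (rl_int al h t) (rl_int (2 * al) g t)
    (rl_int (2 * al) h t) (rl_int (2 * al) g (t - tau))
    (rl_int (2 * al) h (t - tau)) => *; ring.
by move=> M [w [wD wE]]; exists s, M, w.
Qed.

End neumann.

Lemma continuous_for_sum {R : realType} n (f : nat -> R -> R) (t : R) :
  (forall j, {for t, continuous (f j)}) ->
  {for t, continuous (fun u => \sum_(j < n) f j u)}.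
Proof.
move=> cf; elim: n => [|m ih].
  rewrite (_ : (fun u => _) = cst 0); first exact: cst_continuous.
  by apply/funext => u; rewrite big_ord0.
rewrite (_ : (fun u => _) = (fun u => \sum_(j < m) f j u) \+ f m).
  exact: continuousD.
by apply/funext => u; rewrite big_ord_recr.
Qed.

(* Otherwise conversion unfolds integrals when comparing distinct exponents. *)
#[local] Opaque rl_int rl_kernel rl_integrable Gamma.

(** * Fractional integrals and derivatives of finite power sums plus I^2 w *)

Section profile.
Context {R : realType}.
Variables (al s M : R) (n : nat) (c : nat -> R) (w : R -> R).
Hypotheses (al0 : 0 < al) (s0 : 0 < s) (wD : exp_dominated s M w).

(** This is I^r z for z the sum of the c_j t^(j al) / Gamma (j al + 1) plus I^2 w. The formula is
    also used for -1 < r < 0, where it gives derivatives of z-integrals; r > -1 keeps every exponent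
    positive, j = 0 included. *)
Definition profile (r t : R) : R :=
  \sum_(j < n) c j * rl_kernel (j%:R * al + 1 + r) t + rl_int (2 + r) w t.

Lemma profileE (r t : R) : profile r t =
  \sum_(j < n) c j * rl_kernel (j%:R * al + 1 + r) t + rl_int (2 + r) w t.
Proof. by []. Qed.

Lemma profile_exponent_gt0 (j : nat) (r : R) : -1 < r -> 0 < j%:R * al + 1 + r.
Proof.
by move=> r1; have := mulr_ge0 (ler0n R j) (ltW al0); lra.
Qed.

Lemma rl_int_w_exp_dominated (r : R) : -1 < r ->
  exp_dominated s (M * s `^ (- (2 + r))) (rl_int (2 + r) w).
Proof. by move=> r1; apply: rl_int_exp_dominated => //; lra. Qed.

Lemma profile_integrable (b r t : R) : 0 < b -> -1 < r ->
  rl_integrable b (profile r) t.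
Proof.
move=> b0 r1; apply: rl_integrableD.
  apply: (rl_integrable_sum b n (fun j t => c j * rl_kernel (j%:R * al + 1 + r) t)).
  move=> j; apply: rl_integrableZ; apply: rl_integrable_kernel => //.
  exact: profile_exponent_gt0.
by apply: rl_integrable_exp_dominated b0 s0 _; exact: rl_int_w_exp_dominated.
Qed.

Lemma rl_int_profile (b r t : R) : 0 < b -> -1 < r ->
  rl_int b (profile r) t = profile (b + r) t.
Proof.
move=> b0 r1.
have hk j : rl_integrable b (rl_kernel (j%:R * al + 1 + r)) t.
  by apply: rl_integrable_kernel => //; exact: profile_exponent_gt0.
have hs j : rl_integrable b (fun t => c j * rl_kernel (j%:R * al + 1 + r) t) t.
  exact: rl_integrableZ.
rewrite /profile rl_intD.
- rewrite (rl_int_sum b n (fun j t => c j * rl_kernel (j%:R * al + 1 + r) t) t hs).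
  congr (_ + _).
    apply: eq_bigr => j _; rewrite (rl_intZ _ _ _ _ (hk j)).
    by rewrite (rl_int_kernel _ _ _ b0 (profile_exponent_gt0 j r r1)) addrCA.
  have r2 : 0 < 2 + r by lra.
  by rewrite (rl_int_rl_int _ _ _ _ _ _ b0 r2 s0 wD) addrCA.
- exact: (rl_integrable_sum b n (fun j t => c j * rl_kernel (j%:R * al + 1 + r) t) t hs).
- by apply: rl_integrable_exp_dominated b0 s0 _; exact: rl_int_w_exp_dominated.
Qed.

Lemma profile_le0 (r t : R) : t <= 0 -> profile r t = 0.
Proof.
move=> t0; rewrite /profile rl_int_le0 ?addr0//; last by case: wD.
by rewrite big1// => j _; rewrite rl_kernel_le0// mulr0.
Qed.

Lemma profile_exp_dominated (r : R) : 0 <= r -> exists C, exp_dominated s C (profile r).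
Proof.
move=> r0.
have hj (j : nat) : exists C, exp_dominated s C
    (fun t => c j * rl_kernel (j%:R * al + 1 + r) t).
  have [||C CD] := @rl_kernel_exp_dominated R (j%:R * al + 1 + r) s => //.
    by have := mulr_ge0 (ler0n R j) (ltW al0); lra.
  by exists (`|c j| * C); exact: exp_dominatedZ.
have [C CD] := choice hj.
eexists; apply: exp_dominatedD; first exact: (exp_dominated_sum s n C _ CD).
by apply: rl_int_w_exp_dominated; lra.
Qed.

(** The powers are continuous off 0. The last term is I^1 of I^(1+r) w with 1 + r > 0, which spends
    one of the two spare integrations. *)
Lemma profile_continuous (r t : R) : -1 < r -> 0 < t ->
  {for t, continuous (profile r)}.
Proof.
move=> r1 t0; rewrite /profile; apply: continuousD.
  apply: (continuous_for_sum n (fun j u => c j * rl_kernel (j%:R * al + 1 + r) u)) => j.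
  apply: (@continuousM _ R^o (fun=> c j)); first exact: cst_continuous.
  exact: rl_kernel_continuous.
have -> : rl_int (2 + r) w = rl_int 1 (rl_int (1 + r) w).
  have r2 : 0 < 1 + r by lra.
  apply/funext => u; rewrite (rl_int_rl_int _ _ _ _ _ _ ltr01 r2 s0 wD).
  have e : 1 + (1 + r) = 2 + r by ring.
  rewrite e; reflexivity.
have hD : exp_dominated s (M * s `^ (- (1 + r))) (rl_int (1 + r) w).
  by apply: rl_int_exp_dominated => //; lra.
apply: rl_int1_continuous; first by case: hD.
by move=> u; exact: (rl_integrable_exp_dominated _ _ _ _ _ ltr01 s0 hD).
Qed.

Lemma profile_derivable (r t : R) : 0 < r -> 0 < t ->
  derivable (profile r) t 1 /\ derive1 (profile r) t = profile (r - 1) t.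
Proof.
move=> r0 t0; have r1 : -1 < r - 1 by lra.
have -> : profile r = rl_int 1 (profile (r - 1)).
  by apply/funext => u; rewrite (rl_int_profile _ _ _ ltr01 r1) subrKC.
apply: rl_int1_derivable => //; first by move=> u; exact: profile_le0.
  by move=> u; exact: profile_integrable.
exact: profile_continuous.
Qed.

End profile.

(** * Regularity and Caputo derivatives of x = x0 + I^(2 alpha) z *)

Section caputo_profile.
Context {R : realType}.

Lemma near_pos_eq_derive1 (f g : R -> R) (t : R) : 0 < t ->
  (forall u, 0 < u -> f u = g u) -> derivable g t 1 ->
  derivable f t 1 /\ derive1 f t = derive1 g t.
Proof.
move=> t0 fg dg.
have h : \forall u \near t, g u = f u.
  by near=> u; rewrite fg//; near: u; exact: lt_nbhsr.
split; first exact: near_eq_derivable dg.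
by rewrite !derive1E; apply/esym/near_eq_derive.
Unshelve. all: by end_near. Qed.

(** Only the derivative on t > 0 matters, since its value at 0 sits on a null set. The strict bound
    selects the integral branch of [caputo]. *)
Lemma caputo_rl_int (m : nat) (nu t : R) (f h : R -> R) :
  caputo_order nu = m -> nu < m%:R ->
  (forall u, u <= 0 -> h u = 0) -> (forall u, 0 < u -> derive1n m f u = h u) ->
  rl_integrable (m%:R - nu) h t ->
  has_caputo nu f t /\ caputo nu f t = rl_int (m%:R - nu) h t.
Proof.
move=> om lt_m h0 fh hi; have b0 : 0 < m%:R - nu by rewrite subr_gt0.
have [] := rl_int_itv (m%:R - nu) 0 t h (derive1n m f) b0 (lexx 0) h0 _ hi.
  by move=> u /andP[u0 _]; exact: fh.
move=> hI hE; rewrite /has_caputo /caputo /caputo_kernel om (lt_eqF lt_m).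
by split => //; rewrite hE mulKf// gt_eqF// Gamma_gt0.
Qed.

Lemma loc_abs_cont_rl_int (f h : R -> R) :
  (forall u, u <= 0 -> h u = 0) -> (forall u, 0 < u -> derive1 f u = h u) ->
  (forall u, rl_integrable 1 h u) ->
  (forall u, 0 < u -> f u = f 0 + rl_int 1 h u) -> loc_abs_cont f.
Proof.
move=> h0 fh hi fE T T0.
have [] := rl_int_itv 1 0 T h (derive1 f) ltr01 (lexx 0) h0 _ (hi T).
  by move=> u /andP[u0 _]; exact: fh.
rewrite Gamma1 mul1r => hI hE; split.
  by apply: eq_integrable hI => // u _; rewrite subrr powRr0 mul1r.
rewrite fE// -hE; congr (_ + _).
by apply: eq_Rintegral => u _; rewrite subrr powRr0 mul1r.
Qed.

Lemma caputo_order_eq (m : nat) (nu : R) : m%:R < nu -> nu <= m.+1%:R ->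
  caputo_order nu = m.+1.
Proof.
move=> h1 h2; rewrite /caputo_order.
have -> // : Num.ceil nu = m.+1%:Z.
by apply: ceil_def; rewrite intrB -!pmulrn h2 andbT -natr1 addrK.
Qed.

Section solution.
Variables (al s M x0 : R) (n : nat) (c : nat -> R) (w x : R -> R).
Hypotheses (al0 : 0 < al) (al1 : al < 1) (s0 : 0 < s) (wD : exp_dominated s M w).
Local Notation H := (profile al n c w).
Hypothesis xE : forall t, 0 < t -> x t = x0 + H (2 * al) t.
Hypothesis x0E : x 0 = x0.

Let dx t : 0 < t -> derivable x t 1 /\ derive1 x t = H (2 * al - 1) t.
Proof.
move=> t0.
have [d1 d2] := profile_derivable _ _ _ n c _ al0 s0 wD _ _ (mulr_gt0 (ltr0Sn R 1) al0) t0.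
have dc : derivable (cst x0 : R -> R) t 1 by exact: derivable_cst.
have [h ->] := near_pos_eq_derive1 x (cst x0 + H (2 * al)) t t0 xE (derivableD dc d1).
split; first exact: h.
by rewrite derive1E (deriveD dc d1) derive_cst add0r -derive1E d2.
Qed.

Let d2x t : 1 < 2 * al -> 0 < t ->
  derivable (derive1 x) t 1 /\ derive1 (derive1 x) t = H (2 * al - 2) t.
Proof.
move=> al2 t0; have r0 : 0 < 2 * al - 1 by move: al0 al1; lra.
have [d1 d2] := profile_derivable _ _ _ n c _ al0 s0 wD _ _ r0 t0.
have [] := near_pos_eq_derive1 (derive1 x) (H (2 * al - 1)) t t0 _ d1.
  by move=> u /dx[].
move=> h ->; split; first exact: h.
have e : 2 * al - 1 - 1 = 2 * al - 2 by ring.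
rewrite d2 e; reflexivity.
Qed.

Lemma profile_loc_abs_cont : loc_abs_cont x.
Proof.
have r1 : -1 < 2 * al - 1 by move: al0 al1; lra.
apply: (@loc_abs_cont_rl_int x (H (2 * al - 1))).
- by move=> u; exact: (profile_le0 _ _ _ _ _ _ wD).
- by move=> u /dx[].
- by move=> u; exact: (profile_integrable _ _ _ _ _ _ al0 s0 wD _ _ _ _ r1).
- move=> u u0; rewrite x0E (xE u u0).
  by rewrite (rl_int_profile _ _ _ _ _ _ al0 s0 wD _ _ _ ltr01 r1) subrKC.
Qed.

(** The slope at 0 is 0 because x' = I^1 H(2 al - 2) on t > 0, with 2 al - 2 > -1. *)
Lemma profile_derive_loc_abs_cont : 1 < 2 * al ->
  (forall t, 0 < t -> derivable x t 1) /\
  loc_abs_cont (fun t => if t == 0 then 0 else derive1 x t).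
Proof.
move=> al2; split; first by move=> t /dx[].
have r1 : -1 < 2 * al - 2 by move: al0 al1; lra.
apply: (@loc_abs_cont_rl_int _ (H (2 * al - 2))).
- by move=> u; exact: (profile_le0 _ _ _ _ _ _ wD).
- move=> u u0; have [d1 d2] := d2x u al2 u0.
  have fg v : 0 < v -> (if v == 0 then 0 else derive1 x v) = derive1 x v.
    by move=> v0; rewrite gt_eqF.
  have [_ ->] := near_pos_eq_derive1 _ _ u u0 fg d1.
  exact: d2.
- by move=> u; exact: (profile_integrable _ _ _ _ _ _ al0 s0 wD _ _ _ _ r1).
- move=> u u0; rewrite eqxx (gt_eqF u0) add0r.
  rewrite (rl_int_profile _ _ _ _ _ _ al0 s0 wD _ _ _ ltr01 r1).
  have [_ ->] := dx u u0.
  have e : 1 + (2 * al - 2) = 2 * al - 1 by ring.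
  rewrite e; reflexivity.
Qed.

(** x' = H(2 al - 1), and I^(1 - al) raises the order to al. The order 2 al - 1 may be negative, but
    exceeds -1. *)
Lemma caputo_profile t : 0 < t ->
  has_caputo al x t /\ caputo al x t = H al t.
Proof.
move=> t0; have o1 : caputo_order al = 1%N by apply: caputo_order_eq; rewrite ?ltW.
have r1 : -1 < 2 * al - 1 by move: al0 al1; lra.
have b0 : 0 < 1 - al by move: al0 al1; lra.
have [] := @caputo_rl_int 1 al t x (H (2 * al - 1)) o1 al1 _ _ _.
- by move=> u; exact: (profile_le0 _ _ _ _ _ _ wD).
- by move=> u /dx[].
- exact: (profile_integrable _ _ _ _ _ _ al0 s0 wD _ _ _ _ r1).
move=> hc ->; split; first exact: hc.
rewrite (rl_int_profile _ _ _ _ _ _ al0 s0 wD _ _ _ b0 r1).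
have e : 1 - al + (2 * al - 1) = al by ring.
rewrite e; reflexivity.
Qed.

Lemma caputo2_profile t : 0 < t ->
  has_caputo (2 * al) x t /\ caputo (2 * al) x t = H 0 t.
Proof.
move=> t0; have [al2|al2|al2] := ltgtP (2 * al) 1.
- have o1 : caputo_order (2 * al) = 1%N.
    by apply: caputo_order_eq; [rewrite mulr_gt0|exact: ltW].
  have r1 : -1 < 2 * al - 1 by move: al0 al1; lra.
  have b0 : 0 < 1 - 2 * al by move: al0 al1; lra.
  have [] := @caputo_rl_int 1 (2 * al) t x (H (2 * al - 1)) o1 al2 _ _ _.
  + by move=> u; exact: (profile_le0 _ _ _ _ _ _ wD).
  + by move=> u /dx[].
  + exact: (profile_integrable _ _ _ _ _ _ al0 s0 wD _ _ _ _ r1).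
  move=> hc ->; split; first exact: hc.
  rewrite (rl_int_profile _ _ _ _ _ _ al0 s0 wD _ _ _ b0 r1).
  have e : 1 - 2 * al + (2 * al - 1) = 0 by ring.
  rewrite e; reflexivity.
- have o2 : caputo_order (2 * al) = 2%N by apply: caputo_order_eq => //; move: al1; lra.
  have l2 : 2 * al < 2 by move: al1; lra.
  have r1 : -1 < 2 * al - 2 by move: al0 al1; lra.
  have b0 : 0 < 2 - 2 * al by move: al0 al1; lra.
  have [] := @caputo_rl_int 2 (2 * al) t x (H (2 * al - 2)) o2 l2 _ _ _.
  + by move=> u; exact: (profile_le0 _ _ _ _ _ _ wD).
  + by move=> u /(d2x u al2)[].
  + exact: (profile_integrable _ _ _ _ _ _ al0 s0 wD _ _ _ _ r1).
  move=> hc ->; split; first exact: hc.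
  rewrite (rl_int_profile _ _ _ _ _ _ al0 s0 wD _ _ _ b0 r1).
  have e : 2 - 2 * al + (2 * al - 2) = 0 by ring.
  rewrite e; reflexivity.
(* For 2 al = 1 the operator is the ordinary derivative, and x' = H(2 al - 1) is already H 0. *)
- have o1 : caputo_order (2 * al) = 1%N.
    by apply: caputo_order_eq; rewrite al2.
  rewrite /has_caputo /caputo o1 al2 eqxx.
  have [d1 d2] := dx t t0; split; first exact: d1.
  rewrite [LHS]d2 al2 subrr; reflexivity.
Qed.

End solution.
End caputo_profile.

#[local] Opaque profile laplace.

(** * Instability from a forcing whose transform does not vanish at the root *)

Section instability.
Context {R : realType}.

Lemma bounded_exp_dominated (K s : R) (y : R -> R) : 0 < s ->
  measurable_fun setT y -> (forall t, t <= 0 -> y t = 0) ->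
  (forall t, `|y t| <= K) -> exp_dominated s K y.
Proof.
move=> s0 my y0 yK; have K0 : 0 <= K := le_trans (normr_ge0 _) (yK 0).
split => // t; have [t0|t0] := leP t 0.
  by rewrite y0// normr0 mulr_ge0// expR_ge0.
apply: le_trans (yK t) _; rewrite ler_peMr//.
by rewrite -expR0 ler_expR mulr_ge0 ?ltW.
Qed.

(** Transforming the equation at [l] and multiplying by l^(2 al), the characteristic equation
    cancels all terms in the transform of [y], leaving that of [F]. *)
Lemma laplace_forcing_eq0 (al A D B tau l K C : R) (y F : R -> R) :
  0 < al -> 0 <= tau -> 0 < l ->
  l `^ (2 * al) = A * l `^ al + D + B * expR (- (l * tau)) ->
  measurable_fun setT y -> (forall t, t <= 0 -> y t = 0) ->
  (forall t, `|y t| <= K) -> exp_dominated (l / 2) C F ->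
  (forall t, y t = A * rl_int al y t + D * rl_int (2 * al) y t +
     B * rl_int (2 * al) y (t - tau) + rl_int (2 * al) F t) ->
  laplace l F = 0.
Proof.
move=> al0 tau0 l0 root my y0 yK FD yE.
have al20 : 0 < 2 * al by rewrite mulr_gt0.
(* Boundedness makes [y] dominated at every positive rate; [l / 2] is one strictly below [l]. *)
have s0 : 0 < l / 2 by rewrite divr_gt0.
have sl : l / 2 < l by lra.
have yD := bounded_exp_dominated K _ y s0 my y0 yK.
have I1 := rl_int_exp_dominated _ _ _ _ al0 s0 yD.
have I2 := rl_int_exp_dominated _ _ _ _ al20 s0 yD.
have I3 := exp_dominated_shift _ _ tau _ (ltW s0) (exp_dominated_ge0 _ _ _ I2) tau0 I2.
have I4 := rl_int_exp_dominated _ _ _ _ al20 s0 FD.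
have J1 := exp_dominatedZ _ _ A _ I1.
have J2 := exp_dominatedZ _ _ D _ I2.
have J3 := exp_dominatedZ _ _ B _ I3.
have J12 := exp_dominatedD _ _ _ _ _ J1 J2.
have J123 := exp_dominatedD _ _ _ _ _ J12 J3.
have L1 := laplace_rl_int _ _ _ _ _ al0 s0 sl yD.
have L2 := laplace_rl_int _ _ _ _ _ al20 s0 sl yD.
have L4 := laplace_rl_int _ _ _ _ _ al20 s0 sl FD.
have mI2 : measurable_fun setT (rl_int (2 * al) y) by case: I2.
have LE : laplace l y = A * (l `^ (- al) * laplace l y)
    + D * (l `^ (- (2 * al)) * laplace l y)
    + B * (expR (- (l * tau)) * (l `^ (- (2 * al)) * laplace l y))
    + l `^ (- (2 * al)) * laplace l F.
  rewrite -L4 -L2 -L1 -(laplace_shift _ tau _ mI2 (laplace_integrable _ _ _ _ sl I2)).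
  rewrite -(laplaceZ _ _ _ _ _ sl I1) -(laplaceZ _ _ _ _ _ sl I2).
  rewrite -(laplaceZ _ _ _ _ _ sl I3) -(laplaceD _ _ _ _ _ _ sl J1 J2).
  rewrite -(laplaceD _ _ _ _ _ _ sl J12 J3) -(laplaceD _ _ _ _ _ _ sl J123 I4).
  congr (laplace l _); apply/funext; exact: yE.
have P0 : l `^ (2 * al) != 0 by rewrite gt_eqF// powR_gt0.
have Q0 : l `^ al != 0 by rewrite gt_eqF// powR_gt0.
have PQ : l `^ (2 * al) = l `^ al * l `^ al.
  by rewrite mulr2n mulrDl mul1r powRD// (gt_eqF l0) implybT.
move: LE root P0; rewrite !powRN PQ.
move: (l `^ al) (expR (- (l * tau))) (laplace l y) (laplace l F) Q0 => Q E Y W Q0 LE root _.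
have : Q * Q * Y = A * Q * Y + D * Y + B * E * Y + W.
  rewrite {1}LE; field; by rewrite Q0.
rewrite root => h; clear -h.
have -> : W = A * Q * Y + D * Y + B * E * Y + W - (A * Q * Y + D * Y + B * E * Y) by ring.
rewrite -h; ring.
Qed.

Lemma delay_equation_rearranged (a b c h1 h2 h3 f u x0 : R) :
  c != 0 -> c * f = a * x0 + b * u ->
  h1 + c * (- c^-1 * h1 + a / c * h2 + b / c * h3 + f) = a * (x0 + h2) + b * (u + h3).
Proof.
move=> c0 cf.
have -> : h1 + c * (- c^-1 * h1 + a / c * h2 + b / c * h3 + f) =
    a * h2 + b * h3 + c * f by field.
by rewrite cf; ring.
Qed.

Lemma rl_int_delay_sum (be tau A D B t : R) (z h y F : R -> R) :
  measurable_fun setT y ->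
  (forall u, z u = A * h u + D * y u + B * y (u - tau) + F u) ->
  rl_integrable be h t -> rl_integrable be y t ->
  rl_integrable be (fun u => y (u - tau)) t -> rl_integrable be F t ->
  rl_int be z t = A * rl_int be h t + D * rl_int be y t + B * rl_int be y (t - tau)
    + rl_int be F t.
Proof.
move=> my zE ih iy iyt iF.
have -> : z = (fun u => A * h u + D * y u + B * y (u - tau) + F u) by exact/funext.
have i1 := rl_integrableZ be A _ _ ih.
have i2 := rl_integrableZ be D _ _ iy.
have i3 := rl_integrableZ be B _ _ iyt.
rewrite (rl_intD _ _ _ _ (rl_integrableD _ _ _ _ (rl_integrableD _ _ _ _ i1 i2) i3) iF).
rewrite (rl_intD _ _ _ _ (rl_integrableD _ _ _ _ i1 i2) i3) (rl_intD _ _ _ _ i1 i2).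
by rewrite (rl_intZ _ _ _ _ ih) (rl_intZ _ _ _ _ iy) (rl_intZ _ _ _ _ iyt)
  (rl_int_shift _ _ _ _ my).
Qed.

Section generic.
Variables (al a b c tau x0 s M l C : R) (n : nat) (d : nat -> R) (w phi F : R -> R).
Hypotheses (al0 : 0 < al) (al1 : al < 1) (c0 : c != 0) (tau0 : 0 <= tau) (s0 : 0 < s).
Hypothesis (wD : exp_dominated s M w).
Local Notation H := (profile al n d w).

(** Common end of both cases. Substituting x = x0 + H(2 al) leaves c F = a x0 + b u for t > 0, where
    u is the history at t - tau, or x0 once t exceeds the delay. *)
Lemma unstable_of_profile :
  {within `[- tau, 0], continuous phi} -> phi 0 = x0 ->
  (forall t, 0 < t -> c * F t = a * x0 + b * (if t - tau <= 0 then phi (t - tau) else x0)) ->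
  (forall t, H 0 t = (- c^-1) * H al t + (a / c) * H (2 * al) t +
     (b / c) * H (2 * al) (t - tau) + F t) ->
  0 < l -> l `^ (2 * al) = (- c^-1) * l `^ al + a / c + b / c * expR (- (l * tau)) ->
  exp_dominated (l / 2) C F -> laplace l F != 0 ->
  unstable al a b c tau.
Proof.
move=> cphi phi0 FE HE l0 root FD LF st.
have al20 : 0 < 2 * al by rewrite mulr_gt0.
pose x t := if t <= 0 then phi t else x0 + H (2 * al) t.
have xE t : 0 < t -> x t = x0 + H (2 * al) t.
  by move=> t0; rewrite /x leNgt t0.
have x0E : x 0 = x0 by rewrite /x lexx.
have H0 r t : t <= 0 -> H r t = 0.
  exact: (profile_le0 _ _ _ _ _ _ wD).
have xtau t : x (t - tau) =
    (if t - tau <= 0 then phi (t - tau) else x0) + H (2 * al) (t - tau).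
  by rewrite /x; case: ifPn => // h; rewrite H0// addr0.
have sol : is_solution al a b c tau phi 0 x.
  split.
  - by move=> t /andP[_ t0]; rewrite /x t0.
  - exact: (profile_loc_abs_cont _ _ _ _ _ _ _ _ al0 al1 s0 wD xE x0E).
  - exact: (profile_derive_loc_abs_cont _ _ _ _ _ _ _ _ al0 al1 s0 wD xE).
  - move=> t t0; split.
    + by have [] := caputo_profile _ _ _ _ _ _ _ _ al0 al1 s0 wD xE t t0.
    + by have [] := caputo2_profile _ _ _ _ _ _ _ _ al0 al1 s0 wD xE t t0.
  - move=> t t0.
    have [_ ->] := caputo_profile _ _ _ _ _ _ _ _ al0 al1 s0 wD xE t t0.
    have [_ ->] := caputo2_profile _ _ _ _ _ _ _ _ al0 al1 s0 wD xE t t0.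
    rewrite xtau (HE t) (xE t t0).
    exact: (delay_equation_rearranged _ _ _ _ _ _ _ _ _ c0 (FE t t0)).
have Hdom r : 0 <= r -> exists C1, exp_dominated s C1 (H r).
  exact: (profile_exp_dominated _ _ _ n d _ al0 s0 wD r).
have [C2 H2D] := Hdom _ (ltW al20).
have mH2 : measurable_fun setT (H (2 * al)) by case: (H2D).
have [K yK] : exists K, forall t, `|H (2 * al) t| <= K.
  have /ex_bound[K [T [_ xK]]] := st phi 0 x cphi sol.
  (* Stability bounds [x] only beyond some T; up to [|T|] the exponential bound of the construction
     is used. *)
  exists (Num.max (C2 * expR (s * `|T|)) (K + `|x0|)) => t.
  have [tT|Tt] := leP t `|T|.
    rewrite le_max; apply/orP; left; case: (H2D) => _ _ /(_ t) h.
    apply: le_trans h _; apply: ler_wpM2l; first exact: (exp_dominated_ge0 _ _ _ H2D).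
    by rewrite ler_expR ler_wpM2l// ltW.
  have t0 : 0 < t by rewrite (le_lt_trans _ Tt).
  have /xK /= h : T < t by rewrite (le_lt_trans _ Tt)// ler_norm.
  rewrite le_max; apply/orP; right.
  have -> : H (2 * al) t = x t - x0 by rewrite (xE t t0); ring.
  by rewrite (le_trans (ler_normB _ _))// lerD2r.
have l20 : 0 < l / 2 by rewrite divr_gt0.
have HI b' r t (b0 : 0 < b') (r1 : -1 < r) :=
  profile_integrable _ _ _ n d _ al0 s0 wD b' r t b0 r1.
have HR b' r t (b0 : 0 < b') (r1 : -1 < r) :=
  rl_int_profile _ _ _ n d _ al0 s0 wD b' r t b0 r1.
have m10 : -1 < (0 : R) by rewrite ltrN10.
have m1a : -1 < al by rewrite (lt_trans m10).
have m12 : -1 < 2 * al by rewrite (lt_trans m10).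
have SD := exp_dominated_shift _ _ tau _ (ltW s0) (exp_dominated_ge0 _ _ _ H2D) tau0 H2D.
(* I^(2 al) applied to the equation for z = H 0: since fractional integrals commute, only y = I^(2
   al) z remains, and y is bounded. *)
have yE t : H (2 * al) t = (- c^-1) * rl_int al (H (2 * al)) t
    + (a / c) * rl_int (2 * al) (H (2 * al)) t
    + (b / c) * rl_int (2 * al) (H (2 * al)) (t - tau) + rl_int (2 * al) F t.
  have i3 := rl_integrable_exp_dominated _ _ _ t _ al20 s0 SD.
  have i4 := rl_integrable_exp_dominated _ _ _ t _ al20 l20 FD.
  have E := rl_int_delay_sum (2 * al) tau _ _ _ t _ _ _ _ mH2 HE
    (HI _ _ t al20 m1a) (HI _ _ t al20 m12) i3 i4.
  have e1 : rl_int (2 * al) (H 0) t = H (2 * al) t :=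
    etrans (HR _ _ t al20 m10) (congr1 (fun r => H r t) (addr0 (2 * al))).
  have e2 : rl_int (2 * al) (H al) t = rl_int al (H (2 * al)) t :=
    etrans (HR _ _ t al20 m1a) (etrans (congr1 (fun r => H r t) (addrC (2 * al) al))
      (esym (HR _ _ t al0 m12))).
  exact: (etrans (esym e1) (etrans E (congr1 (fun v => (- c^-1) * v
    + (a / c) * rl_int (2 * al) (H (2 * al)) t
    + (b / c) * rl_int (2 * al) (H (2 * al)) (t - tau) + rl_int (2 * al) F t) e2))).
move: LF; rewrite (laplace_forcing_eq0 al (- c^-1) (a / c) (b / c) tau l K C _ _
  al0 tau0 l0 root mH2 (H0 (2 * al)) yK FD yE).
by rewrite eqxx.
Qed.

End generic.
End instability.

(** * A positive root of the characteristic equation *)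

Section roots.
Context {R : realType}.

Lemma powR_2al (l al : R) : 0 < l -> l `^ (2 * al) = l `^ al * l `^ al.
Proof.
by move=> l0; rewrite mulr2n mulrDl mul1r powRD// (gt_eqF l0) implybT.
Qed.

(** In Q = l^al the delay-free part Q^2 - A Q is a parabola with vertex A/2. There the function
    equals A (a - A/4 + b E), E = e^(-l0 tau), which is negative exactly when E > r, that is tau < -
    ln r / l0: this is where the threshold comes from. At Q = A the parabola vanishes and A (a + b
    E) >= A (a + b) > 0, as b < 0 and E <= 1. *)
Lemma characteristic_root (al a b c tau : R) : 0 < al -> c < 0 ->
  0 < a + b -> b < 0 -> - 1 / (4 * c) < a -> 0 <= tau ->
  tau < - ln ((- 1 - 4 * a * c) / (4 * b * c)) / (- 1 / (2 * c)) `^ (1 / al) ->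
  exists l, 0 < l /\
    l `^ (2 * al) = (- c^-1) * l `^ al + a / c + b / c * expR (- (l * tau)).
Proof.
move=> al0 c0 ab0 b0 a4 tau0.
pose A := - c^-1.
have A0 : 0 < A by rewrite oppr_gt0 invr_lt0.
have cA : c = - A^-1 by rewrite /A invrN invrK opprK.
have -> : - 1 / (2 * c) = A / 2.
  by rewrite cA; field; rewrite gt_eqF.
have {}a4 : A / 4 < a.
  by rewrite (_ : A / 4 = - 1 / (4 * c))// cA; field; rewrite gt_eqF.
have -> : (- 1 - 4 * a * c) / (4 * b * c) = (a - A / 4) / (- b).
  by rewrite cA; field; rewrite (gt_eqF A0) (lt_eqF b0).
set r := (a - A / 4) / (- b); set l0 := (A / 2) `^ (1 / al) => tau_lt.
have r0 : 0 < r by rewrite divr_gt0 ?subr_gt0 ?oppr_gt0.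
have A20 : 0 < A / 2 by rewrite divr_gt0.
have l00 : 0 < l0 by rewrite powR_gt0.
have pow_inv u : 0 < u -> (u `^ (1 / al)) `^ al = u.
  by move=> u0; rewrite -powRrM mul1r mulVf ?gt_eqF// powRr1 ?ltW.
pose l1 := A `^ (1 / al).
have l01 : l0 <= l1.
  apply: ge0_ler_powR; rewrite ?nnegrE ?(ltW A20) ?(ltW A0)//.
    by rewrite divr_ge0// ltW.
  by rewrite ler_pdivrMr// ler_peMr ?(ltW A0)// ler1n.
(* The characteristic function divided by c, with 1/c = -A. *)
pose G l := l `^ al * l `^ al - A * l `^ al + A * a + A * b * expR (- (l * tau)).
have cG : {within `[l0, l1], continuous G}.
  apply: continuous_in_subspaceT => l; rewrite inE/= in_itv/= => /andP[ll _].
  have lp : 0 < l := lt_le_trans l00 ll.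
  have cp : {for l, continuous (fun l : R => l `^ al)}.
    apply/differentiable_continuous/derivable1_diffP.
    by apply: derivable_powR; rewrite in_itv/= andbT.
  have ce : {for l, continuous (fun l : R => expR (- (l * tau)))}.
    apply: (@continuous_comp _ _ _ (fun l : R => - (l * tau)) expR).
      apply: (@continuousN _ R^o).
      apply: (@continuousM _ R^o id (fun=> tau)); first exact: cvg_id.
      exact: cst_continuous.
    exact: continuous_expR.
  have c1 := @continuousM _ R^o _ _ l cp cp.
  have c2 := @continuousM _ R^o (fun=> A) _ l (@cst_continuous R R A l) cp.
  have c3 := @continuousM _ R^o (fun=> A * b) _ l (@cst_continuous R R (A * b) l) ce.
  exact: (continuousD (continuousD (continuousB c1 c2) (@cst_continuous R R (A * a) l)) c3).
have E0 : r < expR (- (l0 * tau)).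
  rewrite -[r]lnK ?posrE// ltr_expR ltrNr mulrC -ltr_pdivlMr//.
have Gl0 : G l0 <= 0.
  rewrite /G /l0 (pow_inv _ A20).
  have : - b * r < - b * expR (- (l0 * tau)) by rewrite ltr_pM2l ?oppr_gt0.
  rewrite {1}/r mulrC divfK ?oppr_eq0 ?lt_eqF// -/l0 => h.
  have h2 : 0 <= A * (- b * expR (- (l0 * tau)) - (a - A / 4)).
    by rewrite mulr_ge0 ?(ltW A0)// subr_ge0 ltW.
  rewrite -oppr_ge0; apply: le_trans h2 _; rewrite le_eqVlt; apply/orP; left.
  by apply/eqP; field.
have E1 : expR (- (l1 * tau)) <= 1.
  by rewrite -expR0 ler_expR oppr_le0 mulr_ge0 ?powR_ge0.
have Gl1 : 0 <= G l1.
  rewrite /G /l1 (pow_inv _ A0) -/l1 subrr add0r -mulrA -mulrDr mulr_ge0 ?(ltW A0)//.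
  apply: le_trans (ltW ab0) _; rewrite lerD2l -[leLHS]mulr1 ler_nM2l//.
have [|l lI Gl] := IVT (v := 0) l01 cG.
  apply/andP; split; first by rewrite ge_min; apply/orP; left; exact: Gl0.
  by rewrite le_max; apply/orP; right; exact: Gl1.
move: lI; rewrite in_itv/= => /andP[ll _].
have lp : 0 < l := lt_le_trans l00 ll.
exists l; split => //; rewrite powR_2al//.
have -> : a / c = - (A * a) by rewrite /A; field; rewrite lt_eqF.
have -> : b / c = - (A * b) by rewrite /A; field; rewrite lt_eqF.
move: Gl; rewrite /G -/A; move: (l `^ al) (expR (- (l * tau))) => Q E Gl.
by apply/eqP; rewrite -subr_eq0 -Gl; apply/eqP; ring.
Qed.

End roots.

(** * Backward differences and a compactly supported spline *)

Section backward_difference.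
Context {R : realType}.

Definition bdiff (e : R) (g : R -> R) (t : R) : R := g t + (-1) * g (t - e).

Lemma bdiff_exp_dominated (s C e : R) (g : R -> R) : 0 <= s -> 0 <= e ->
  exp_dominated s C g -> exists C', exp_dominated s C' (bdiff e g).
Proof.
move=> s0 e0 gD; exists (C + `|-1| * C).
apply: exp_dominatedD => //; apply: exp_dominatedZ.
by apply: exp_dominated_shift => //; exact: exp_dominated_ge0 gD.
Qed.

Lemma rl_int_bdiff (b s C e t : R) (g : R -> R) : 0 < b -> 0 < s -> 0 <= e ->
  exp_dominated s C g -> rl_int b (bdiff e g) t = bdiff e (rl_int b g) t.
Proof.
move=> b0 s0 e0 gD; have mg : measurable_fun setT g by case: gD.
have i1 := rl_integrable_exp_dominated _ _ _ t _ b0 s0 gD.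
have sD := exp_dominated_shift _ _ e _ (ltW s0) (exp_dominated_ge0 _ _ _ gD) e0 gD.
have i2 := rl_integrable_exp_dominated _ _ _ t _ b0 s0 sD.
rewrite /bdiff (rl_intD _ _ _ _ i1 (rl_integrableZ _ (-1) _ _ i2)).
by rewrite (rl_intZ _ _ _ _ i2) (rl_int_shift _ _ _ _ mg).
Qed.

Lemma laplace_bdiff (s C e l : R) (g : R -> R) : 0 <= s -> s < l -> 0 <= e ->
  exp_dominated s C g ->
  laplace l (bdiff e g) = (1 - expR (- (l * e))) * laplace l g.
Proof.
move=> s0 sl e0 gD; have mg : measurable_fun setT g by case: gD.
have sD := exp_dominated_shift _ _ e _ s0 (exp_dominated_ge0 _ _ _ gD) e0 gD.
rewrite (laplaceD _ _ _ _ _ _ sl gD (exp_dominatedZ _ _ (-1) _ sD)).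
rewrite (laplaceZ _ _ _ _ _ sl sD) (laplace_shift _ _ _ mg); last first.
  exact: laplace_integrable sl gD.
by ring.
Qed.

Lemma bdiff_continuous (e : R) (g : R -> R) : continuous g -> continuous (bdiff e g).
Proof.
move=> cg t; have c1 : {for t, continuous (fun t => g (t - e))}.
  apply: continuous_comp; last exact: cg.
  apply: continuousB; [exact: cvg_id|exact: cst_continuous].
have c2 := @continuousM _ R^o (fun=> -1) _ t (@cst_continuous R R (-1) t) c1.
exact: (continuousD (cg t) c2).
Qed.

(* A quadratic B-spline supported on [0, 3 e], up to a factor: a forcing of this
   form vanishes after the delay, so it can be produced by the history alone. *)
Definition spline (e : R) : R -> R := bdiff e (bdiff e (bdiff e (rl_kernel 3))).

Lemma spline_ge (e t : R) : 0 <= e -> 3 * e <= t -> spline e t = 0.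
Proof.
(* For t >= 3 e all four nodes are nonnegative, where the kernel is the quadratic u^2 / Gamma 3,
   whose third difference is zero. *)
move=> e0 te.
have k3 u : 0 <= u -> rl_kernel 3 u = u ^+ 2 / Gamma 3.
  rewrite le_eqVlt => /predU1P[<-|u0]; first by rewrite rl_kernel_le0// expr0n mul0r.
  rewrite rl_kernel_gt0//.
  rewrite (_ : 3 - 1 = 2%:R); last by rewrite -[3]/(1 + 2%:R); lra.
  by rewrite powR_mulrn// ltW.
rewrite /spline /bdiff !k3; lra.
Qed.

Lemma spline_continuous (e : R) : continuous (spline e).
Proof.
do 3 apply: bdiff_continuous.
have -> : rl_kernel 3 = rl_int 1 (rl_kernel 2) :> (R -> R).
  apply/funext => t; rewrite (rl_int_kernel _ _ _ ltr01 (ltr0Sn R 1)).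
  by rewrite -natr1 addrC.
apply: rl_int1_continuous; first by move=> u; exact: rl_kernel_le0.
by move=> u; exact: (rl_integrable_kernel _ _ _ ltr01 (ltr0Sn R 1)).
Qed.

Lemma bdiff3_kernel_exp_dominated (e b s : R) : 0 <= e -> 1 <= b -> 0 < s ->
  exists C, exp_dominated s C (bdiff e (bdiff e (bdiff e (rl_kernel b)))).
Proof.
move=> e0 b1 s0; have [C0 D0] := rl_kernel_exp_dominated b s b1 s0.
have [C1 D1] := bdiff_exp_dominated _ _ e _ (ltW s0) e0 D0.
have [C2 D2] := bdiff_exp_dominated _ _ e _ (ltW s0) e0 D1.
exact: (bdiff_exp_dominated _ _ e _ (ltW s0) e0 D2).
Qed.

(** Exhibits the spline as I^2 of a bounded step function, the form of forcing compatible with z =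
    I^2 w. *)
Lemma rl_int2_spline (e t : R) : 0 <= e ->
  rl_int 2 (bdiff e (bdiff e (bdiff e (rl_kernel 1)))) t = spline e t.
Proof.
move=> e0; have b2 : (0 : R) < 2 := ltr0Sn R 1.
have [C0 D0] := rl_kernel_exp_dominated 1 1 (lexx 1) (@ltr01 R).
have [C1 D1] := bdiff_exp_dominated _ _ e _ (@ler01 R) e0 D0.
have [C2 D2] := bdiff_exp_dominated _ _ e _ (@ler01 R) e0 D1.
rewrite (rl_int_bdiff _ _ _ _ _ _ b2 ltr01 e0 D2) /spline.
congr (bdiff e _ t); apply/funext => u.
rewrite (rl_int_bdiff _ _ _ _ _ _ b2 ltr01 e0 D1).
congr (bdiff e _ u); apply/funext => v.
rewrite (rl_int_bdiff _ _ _ _ _ _ b2 ltr01 e0 D0).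
congr (bdiff e _ v); apply/funext => x.
by rewrite (rl_int_kernel _ _ _ b2 ltr01) natr1.
Qed.

(** Each difference multiplies the transform by 1 - e^(-l e), so it equals (1 - e^(-l e))^3
    l^(-3). *)
Lemma laplace_spline_neq0 (e l : R) : 0 < e -> 0 < l -> laplace l (spline e) != 0.
Proof.
move=> e0 l0; have s0 : 0 < l / 2 by rewrite divr_gt0.
have sl : l / 2 < l by lra.
have b3 : (1 : R) <= 3 by rewrite ler1n.
have [C0 D0] := rl_kernel_exp_dominated 3 _ b3 s0.
have [C1 D1] := bdiff_exp_dominated _ _ e _ (ltW s0) (ltW e0) D0.
have [C2 D2] := bdiff_exp_dominated _ _ e _ (ltW s0) (ltW e0) D1.
rewrite (laplace_bdiff _ _ _ _ _ (ltW s0) sl (ltW e0) D2).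
rewrite (laplace_bdiff _ _ _ _ _ (ltW s0) sl (ltW e0) D1).
rewrite (laplace_bdiff _ _ _ _ _ (ltW s0) sl (ltW e0) D0).
have E1 : 1 - expR (- (l * e)) != 0.
  by rewrite subr_eq0 eq_sym lt_eqF// expR_lt1 oppr_lt0 mulr_gt0.
rewrite (laplace_rl_kernel 3 l (ltr0Sn R 2) l0).
by rewrite !mulf_neq0// gt_eqF// powR_gt0.
Qed.

End backward_difference.

(** * Unbounded solutions with and without delay *)

Section cases.
Context {R : realType}.

(** I^2 commutes with the fractional integrals and the shift, so I^2 w solves the equation with
    forcing I^2 f. *)
Lemma delay_volterra_integrated (al A D B tau s0 C : R) (f : R -> R) :
  0 < al -> 0 <= tau -> 0 < s0 -> exp_dominated s0 C f ->
  exists s M w, [/\ 0 < s, exp_dominated s M w & forall t,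
    rl_int 2 w t = A * rl_int (2 + al) w t + D * rl_int (2 + 2 * al) w t
      + B * rl_int (2 + 2 * al) w (t - tau) + rl_int 2 f t].
Proof.
move=> al0 tau0 s00 fD.
have [s [M [w [s_gt0 wD wE]]]] := delay_volterra_solution al A D B tau s0 C f al0 tau0 s00 fD.
exists s, M, w; split => // t.
have al20 : 0 < 2 * al by rewrite mulr_gt0.
have b2 : (0 : R) < 2 := ltr0Sn R 1.
have I1 := rl_int_exp_dominated _ _ _ _ al0 s_gt0 wD.
have I2 := rl_int_exp_dominated _ _ _ _ al20 s_gt0 wD.
have I3 := exp_dominated_shift _ _ tau _ (ltW s_gt0) (exp_dominated_ge0 _ _ _ I2) tau0 I2.
have mI2 : measurable_fun setT (rl_int (2 * al) w) by case: (I2).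
have wE' u : w u = A * rl_int al w u + D * rl_int (2 * al) w u
    + B * rl_int (2 * al) w (u - tau) + f u by rewrite {1}wE addrC.
have E := rl_int_delay_sum 2 tau _ _ _ t _ _ _ _ mI2 wE'
  (rl_integrable_exp_dominated _ _ _ t _ b2 s_gt0 I1)
  (rl_integrable_exp_dominated _ _ _ t _ b2 s_gt0 I2)
  (rl_integrable_exp_dominated _ _ _ t _ b2 s_gt0 I3)
  (rl_integrable_exp_dominated _ _ _ t _ b2 s00 fD).
exact: (etrans E (f_equal3 (fun x y z => A * x + D * y + B * z + rl_int 2 f t)
  (rl_int_rl_int _ _ _ _ t _ b2 al0 s_gt0 wD)
  (rl_int_rl_int _ _ _ _ t _ b2 al20 s_gt0 wD)
  (rl_int_rl_int _ _ _ _ (t - tau) _ b2 al20 s_gt0 wD))).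
Qed.

(** With x0 = 0 and history (c/b) times the spline shifted by tau, the delayed term b x(t - tau)
    supplies c times the spline up to time tau; afterwards both vanish. The power sum is empty. *)
Lemma unstable_pos_delay (al a b c tau l : R) :
  0 < al -> al < 1 -> c != 0 -> b != 0 -> 0 < tau -> 0 < l ->
  l `^ (2 * al) = (- c^-1) * l `^ al + a / c + b / c * expR (- (l * tau)) ->
  unstable al a b c tau.
Proof.
move=> al0 al1 c0 b0 tau0 l0 root.
(* The support [0, 3 e] is then exactly [0, tau], and the history vanishes at 0 as x0 = 0
   demands. *)
pose e := tau / 3; have e0 : 0 < e by rewrite divr_gt0.
have te : 3 * e = tau by rewrite /e; field.
have [C1 D1] := bdiff3_kernel_exp_dominated e 1 1 (ltW e0) (lexx 1) ltr01.
have [s [M [w [s0 wD wE]]]] := delay_volterra_integrated al (- c^-1) (a / c) (b / c)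
  tau _ _ _ al0 (ltW tau0) ltr01 D1.
have l20 : 0 < l / 2 by rewrite divr_gt0.
have [C3 D3] := bdiff3_kernel_exp_dominated e 3 _ (ltW e0) (ler1n R 3) l20.
apply: (unstable_of_profile al a b c tau 0 s M l C3 0 (fun=> 0) w
  (fun u => c / b * spline e (u + tau)) (spline e) al0 al1 c0 (ltW tau0) s0 wD
  _ _ _ _ l0 root D3 (laplace_spline_neq0 e l e0 l0)).
- apply: continuous_subspaceT => u.
  have cu : {for u, continuous (fun u => spline e (u + tau))}.
    apply: continuous_comp; last exact: spline_continuous.
    by apply: continuousD; [exact: cvg_id|exact: cst_continuous].
  exact: (@continuousM _ R^o (fun=> c / b) _ u (@cst_continuous R R (c / b) u) cu).
- by rewrite add0r spline_ge ?mulr0 ?te// ltW.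
- move=> t t0; rewrite mulr0 add0r; case: ifPn => h.
    by rewrite subrK; field; rewrite b0.
  rewrite mulr0 spline_ge ?mulr0 ?(ltW e0)// te.
  by move: h; rewrite -ltNge subr_gt0 => /ltW.
- move=> t.
  have P r v : profile al 0 (fun=> 0) w r v = rl_int (2 + r) w v.
    by rewrite profileE big_ord0 add0r.
  have P0 : profile al 0 (fun=> 0) w 0 t = rl_int 2 w t :=
    etrans (P 0 t) (congr1 (fun r => rl_int r w t) (addr0 2)).
  exact: (etrans P0 (etrans (wE t) (f_equal2 +%R
    (f_equal3 (fun x y z => - c^-1 * x + a / c * y + b / c * z)
      (esym (P al t)) (esym (P (2 * al) t)) (esym (P (2 * al) (t - tau))))
    (rl_int2_spline e t (ltW e0))))).
Qed.

(** [K j] stands for t^(j al) / Gamma (j al + 1), so I^al shifts the index by one. The recurrence is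
    coefficient matching in z = A I^al z - q I^(2 al) z - q; truncation leaves only the orders m+1
    and m+2. *)
Lemma frobenius_telescope (A q : R) (d K : nat -> R) (m : nat) :
  d 0%N = - q -> d 1%N = A * d 0%N -> (forall j, d j.+2 = A * d j.+1 - q * d j) ->
  \sum_(j < m.+1) d j * (K j - A * K j.+1 + q * K j.+2) =
  - q * K 0%N - d m.+1 * K m.+1 + q * d m * K m.+2.
Proof.
move=> d0 d1 dS; elim: m => [|m ih].
  by rewrite big_ord_recr big_ord0/= add0r d1 d0; ring.
by rewrite big_ord_recr/= ih dS; ring.
Qed.

(** The [v]'s are the power parts and the [i]'s the I^2 w parts of z, I^al z and I^(2 al) z. The
    defect [f] of the truncated powers is the forcing that w absorbs. *)
Lemma frobenius_balance (A D B q v0 v1 v2 i0 i1 i2 k f : R) :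
  q = - (D + B) -> v0 - A * v1 + q * v2 = - q * k - f ->
  i0 = A * i1 + D * i2 + B * i2 + f ->
  v0 + i0 = A * (v1 + i1) + D * (v2 + i2) + B * (v2 + i2) + - q * k.
Proof.
move=> qE vE ->.
have -> : v0 = v0 - A * v1 + q * v2 + A * v1 - q * v2 by ring.
by rewrite vE qE; ring.
Qed.

Lemma frobenius_coefficients (A q : R) : exists d : nat -> R,
  [/\ d 0%N = - q, d 1%N = A * d 0%N & forall j, d j.+2 = A * d j.+1 - q * d j].
Proof.
pose step (p : R * R) := (p.2, A * p.2 - q * p.1).
by exists (fun j => (iter j step (- q, A * - q)).1).
Qed.

(* The coefficients [d] make the powers cancel up to order [m * al]; the remaining
   forcing is then of the form [I^2 f] with [f] locally bounded, as [1 <= m.+1 * al - 1]. *)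
Lemma unstable_no_delay (al a b c l : R) :
  0 < al -> al < 1 -> c != 0 -> a + b != 0 -> 0 < l ->
  l `^ (2 * al) = (- c^-1) * l `^ al + a / c + b / c * expR (- (l * 0)) ->
  unstable al a b c 0.
Proof.
move=> al0 al1 c0 ab0 l0 root.
pose A := - c^-1; pose q := - ((a + b) / c).
have [d [d0 d1 dS]] := frobenius_coefficients A q.
pose m := Num.Def.archi_bound (2 / al).
have mal : 2 < m%:R * al.
  by rewrite -ltr_pdivrMr//; apply: archi_boundP; rewrite divr_ge0// ltW.
have e1 : 1 <= m.+1%:R * al - 1.
  by rewrite -natr1 mulrDl mul1r; move: mal al0; move: (m%:R * al) => v; lra.
have e2 : 1 <= m.+2%:R * al - 1.
  by apply: (le_trans e1); rewrite lerD2r ler_pM2r// ler_nat.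
have [C1 D1] := rl_kernel_exp_dominated _ 1 e1 ltr01.
have [C2 D2] := rl_kernel_exp_dominated _ 1 e2 ltr01.
have fD := exp_dominatedD _ _ _ _ _ (exp_dominatedZ _ _ (d m.+1) _ D1)
  (exp_dominatedZ _ _ (- q * d m) _ D2).
have [s [M [w [s0 wD wE]]]] := delay_volterra_integrated al A (a / c) (b / c)
  0 _ _ _ al0 (lexx 0) ltr01 fD.
have l20 : 0 < l / 2 by rewrite divr_gt0.
have sl : l / 2 < l by lra.
have [C3 D3] := rl_kernel_exp_dominated 1 _ (lexx 1) l20.
have b2 : (0 : R) < 2 := ltr0Sn R 1.
have g1 : 0 < m.+1%:R * al - 1 := lt_le_trans ltr01 e1.
have g2 : 0 < m.+2%:R * al - 1 := lt_le_trans ltr01 e2.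
(* Constant history 1: the forcing is (a + b)/c on t > 0, with nonzero transform because a + b !=
   0. *)
apply: (unstable_of_profile al a b c 0 1 s M l _ m.+1 d w (fun=> 1)
  (fun t => - q * rl_kernel 1 t) al0 al1 c0 (lexx 0) s0 wD _ _ _ _ l0 root
  (exp_dominatedZ _ _ (- q) _ D3)).
- by apply: continuous_subspaceT => u; exact: cst_continuous.
- by [].
- move=> t t0; rewrite rl_kernel_gt0// subrr powRr0 Gamma1 divr1 mulr1.
  by rewrite if_same /q opprK; field.
- move=> t; pose K (j : nat) := rl_kernel (j%:R * al + 1) t.
  pose S i := \sum_(j < m.+1) d j * K (j + i)%N.
  have PS (i : nat) r u : r = i%:R * al -> u = t ->
      profile al m.+1 d w r u = S i + rl_int (2 + r) w t.
    move=> -> ->; rewrite profileE; congr (_ + _); apply: eq_bigr => j _.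
    by rewrite /K natrD mulrDl addrAC.
  have P0 : profile al m.+1 d w 0 t = S 0%N + rl_int 2 w t :=
    etrans (PS 0%N 0 t (esym (mul0r al)) erefl)
      (congr1 (fun r => S 0%N + rl_int r w t) (addr0 2)).
  have P1 := PS 1%N al t (esym (mul1r al)) erefl.
  have P2 := PS 2%N (2 * al) t erefl erefl.
  have P2' := PS 2%N (2 * al) (t - 0) erefl (subr0 t).
  have I : rl_int 2 w t = A * rl_int (2 + al) w t + a / c * rl_int (2 + 2 * al) w t
      + b / c * rl_int (2 + 2 * al) w t + (d m.+1 * K m.+1 - q * d m * K m.+2).
    have i1 := rl_integrable_kernel _ _ t b2 g1.
    have i2 := rl_integrable_kernel _ _ t b2 g2.
    have J1 : rl_int 2 (rl_kernel (m.+1%:R * al - 1)) t = K m.+1.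
      apply: (etrans (rl_int_kernel _ _ _ b2 g1)); congr (rl_kernel _ t); ring.
    have J2 : rl_int 2 (rl_kernel (m.+2%:R * al - 1)) t = K m.+2.
      apply: (etrans (rl_int_kernel _ _ _ b2 g2)); congr (rl_kernel _ t); ring.
    apply: (etrans (wE t)); apply: (f_equal2 +%R).
      exact: (congr1 (fun v => A * rl_int (2 + al) w t + a / c * rl_int (2 + 2 * al) w t
        + b / c * rl_int (2 + 2 * al) w v) (subr0 t)).
    apply: (etrans (rl_intD _ _ _ _ (rl_integrableZ _ (d m.+1) _ _ i1)
      (rl_integrableZ _ (- q * d m) _ _ i2))).
    rewrite -mulNr -mulNr; apply: (f_equal2 +%R).
      exact: (etrans (rl_intZ _ (d m.+1) _ _ i1) (congr1 ( *%R (d m.+1)) J1)).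
    exact: (etrans (rl_intZ _ (- q * d m) _ _ i2) (congr1 ( *%R (- q * d m)) J2)).
  have T : S 0%N - A * S 1%N + q * S 2%N =
      - q * K 0%N - (d m.+1 * K m.+1 - q * d m * K m.+2).
    rewrite opprB addrA addrAC.
    rewrite -(frobenius_telescope A q d K m d0 d1 dS) /S !mulr_sumr -sumrB -big_split/=.
    by apply: eq_bigr => j _; rewrite addn0 addn1 addn2; ring.
  have K0 : K 0%N = rl_kernel 1 t by rewrite /K mul0r add0r.
  apply: (etrans P0); apply: esym.
  apply: (etrans (f_equal4 (fun x y z u => - c^-1 * x + a / c * y + b / c * z + - q * u)
    P1 P2 P2' (esym K0))).
  apply: esym; apply: frobenius_balance T I.
  by rewrite /q; field.
- rewrite (laplaceZ _ _ _ _ _ sl D3) (laplace_rl_kernel 1 l ltr01 l0).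
  apply: mulf_neq0; last by rewrite gt_eqF// powR_gt0.
  by rewrite /q opprK mulf_neq0// invr_eq0.
Qed.

End cases.

Theorem theoremV3 (R : realType) (alpha a b c : R)
    (alpha_gt0 : 0 < alpha) (alpha_lt1 : alpha < 1) (c_neq0 : c != 0)
    (ab_gt0 : 0 < a + b) (ab_lt : a + b < - 1 / (4 * c))
    (a_gt : - 1 / (4 * c) < a) (b_lt0 : b < 0) :
  exists tau_star : R,
    tau_star = - ln ((- 1 - 4 * a * c) / (4 * b * c))
               / (- 1 / (2 * c)) `^ (1 / alpha) /\
    forall tau : R, 0 <= tau -> tau < tau_star ->
      unstable alpha a b c tau.
Proof.
have c_lt0 : c < 0.
  have := lt_trans ab_gt0 ab_lt; rewrite mulN1r oppr_gt0 invr_lt0.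
  by rewrite pmulr_rlt0.
eexists; split; first reflexivity.
move=> tau tau_ge0 tau_lt.
have [l [l_gt0 root]] := characteristic_root _ _ _ _ _ alpha_gt0 c_lt0 ab_gt0 b_lt0
  a_gt tau_ge0 tau_lt.
move: tau_ge0; rewrite le_eqVlt => /predU1P[tau0|tau_gt0].
  rewrite -tau0 in root *.
  by apply: (unstable_no_delay _ _ _ _ l) => //; rewrite gt_eqF.
by apply: (unstable_pos_delay _ _ _ _ _ l) => //; rewrite lt_eqF.
Qed.
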